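(* Let $T\in\mathbb{N}$, let $(\Omega,\mathcal{F},(\mathcal{F}_t)_{t=0,\ldots,T},\mathbb{P})$ be a filtered probability space in discrete time, and let $\mathbb{X}=\{X^1,\ldots,X^d\}$, $d\in\mathbb{N}$, be a (discounted) market of adapted processes $X^i=(X^i_t)_{t=0,\ldots,T}$ with $X^i\geq0$ for $i=1,\ldots,d$; write $X=(X^1,\ldots,X^d)$. Let $$\mathcal{K}_0:=\Big\{\sum_{t=1}^T\xi_t\cdot(X_t-X_{t-1}):\xi\text{ is a strategy}\Big\}\subset L^0,\qquad \mathcal{C}:=(\mathcal{K}_0-L^0_+)\cap L^1.$$ Then the following statements are equivalent: (i) $\mathcal{K}_0$ satisfies NA, that is, $\mathcal{K}_0\cap L^0_+=\{0\}$. (ii) There exists an EMM $\mathbb{Q}\approx\mathbb{P}$ for $\mathbb{X}$. (iii) There exists an EMM $\mathbb{Q}\approx\mathbb{P}$ for $\mathbb{X}$ with bounded Radon-Nikodym derivative $\frac{d\mathbb{Q}}{d\mathbb{P}}\in L^\infty_{++}$. (iv) There exists a separating measure $\mathbb{Q}\approx\mathbb{P}$ for $\mathcal{C}$. (v) There exists a separating measure $\mathbb{Q}\approx\mathbb{P}$ for $\mathcal{C}$ with bounded Radon-Nikodym derivative $\frac{d\mathbb{Q}}{d\mathbb{P}}\in L^\infty_{++}$.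
   Context: $L^p=L^p(\Omega,\mathcal{F},\mathbb{P})$; $L^0$ is the space of a.s. equivalence classes of real-valued random variables, $L^0_+$ its nonnegative elements; $L^\infty_{++}$ is the set of $Y\in L^\infty$ with $\mathbb{P}(Y>0)=1$. A strategy is an $\mathbb{R}^d$-valued predictable process $\xi=(\xi_t)_{t=1,\ldots,T}$, i.e. $\xi_t$ is $\mathcal{F}_{t-1}$-measurable for each $t=1,\ldots,T$. An equivalent martingale measure (EMM) for $\mathbb{X}$ is a probability measure $\mathbb{Q}\approx\mathbb{P}$ such that $X^1,\ldots,X^d$ are $\mathbb{Q}$-martingales. A probability measure $\mathbb{Q}$ on $(\Omega,\mathcal{F})$ is a separating measure for $\mathcal{C}$ if each $Y\in\mathcal{C}$ is quasi-integrable under $\mathbb{Q}$ (i.e. $\mathbb{E}_{\mathbb{Q}}[Y^+]<\infty$ or $\mathbb{E}_{\mathbb{Q}}[Y^-]<\infty$) and $\mathbb{E}_{\mathbb{Q}}[Y]\leq0$ for all $Y\in\mathcal{C}$. *)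

(* Defs.v *)
From HB Require Import structures.
From mathcomp Require Import all_boot all_order all_algebra.
From mathcomp Require Import all_classical all_reals all_analysis.
Set Implicit Arguments.
Unset Strict Implicit.
Unset Printing Implicit Defensive.
Import Order.TTheory GRing.Theory Num.Theory.
Import numFieldNormedType.Exports.
Local Open Scope classical_set_scope.
Local Open Scope ring_scope.

(* Sub-sigma-algebras of the measurable sets of [Omega] are given as sets of
   sets.  Processes are indexed by [nat]; only the times [t <= T] matter. *)

Section filtrations.
Context d (Omega : measurableType d) (R : realType).
Implicit Types (G : set (set Omega)) (F : nat -> set (set Omega)).

Definition filtration (T : nat) F : Prop :=
  [/\ forall t, (t <= T)%N -> sigma_algebra setT (F t),
      forall t, (t <= T)%N -> F t `<=` measurable &
      forall s t, (s <= t <= T)%N -> F s `<=` F t].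

(* [g_sigma_algebraType G] carries the sigma-algebra generated by [G], which is
   [G] itself when [G] is a sigma-algebra. *)
Definition measurable_wrt G (f : Omega -> R) : Prop :=
  measurable_fun [set: g_sigma_algebraType G] (f : g_sigma_algebraType G -> R).

Definition adapted (T : nat) F (X : nat -> Omega -> R) : Prop :=
  forall t, (t <= T)%N -> measurable_wrt (F t) (X t).

(* [Z] is a version of the conditional expectation of [Y] given [G]. *)
Definition is_cond_exp (Q : probability Omega R) G (Y Z : Omega -> R) : Prop :=
  [/\ measurable_wrt G Z, Q.-integrable setT (EFin \o Z) &
      forall A, G A ->
        (\int[Q]_(w in A) (Z w)%:E = \int[Q]_(w in A) (Y w)%:E)%E].

Definition martingale (Q : probability Omega R) (T : nat) F
    (X : nat -> Omega -> R) : Prop :=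
  [/\ adapted T F X,
      forall t, (t <= T)%N -> Q.-integrable setT (EFin \o X t) &
      forall s t, (s <= t <= T)%N -> is_cond_exp Q (F s) (X t) (X s)].

End filtrations.

Section spaces.
Context d (Omega : measurableType d) (R : realType) (P : probability Omega R).

(* Elements of [L0] are P-a.s. equivalence classes, coerced to functions by
   choosing a representative. *)
Local Notation L0 := {mfun_ P, Omega >-> R}.

Definition L0_zero : L0 := \pi_(L0)%qT (cst 0 : {mfun Omega >-> R}).

Definition L0_ge0 : set L0 := [set Y : L0 | \forall w \ae P, 0 <= Y w].

Definition Lp (p : \bar R) : set L0 := [set Y : L0 | (Y : Omega -> R) \in Lfun P p].

Definition Linfty_pos : set L0 :=
  [set Y : L0 | Lp +oo%E Y /\ P [set w | 0 < Y w] = 1%E].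

Definition L0_setB (A B : set L0) : set L0 :=
  [set Y : L0 | exists2 U, A U & exists2 V, B V & Y = (U \- V) %[ae P]].

Definition equivalent (Q : probability Omega R) : Prop := Q `<< P /\ P `<< Q.

(* dQ/dP belongs to [Linfty_pos]; the library's derivative is a fixed
   extended-real-valued version, so it is compared with a class in [L0]. *)
Definition bounded_pos_density (Q : probability Omega R) : Prop :=
  exists2 Z : L0, Linfty_pos Z &
    (EFin \o Z) = Radon_Nikodym (charge_of_finite_measure Q) P %[ae P].

Definition quasi_integrable (Q : probability Omega R) (Y : Omega -> R) : Prop :=
  ('E_Q[Y^\+] < +oo)%E \/ ('E_Q[Y^\-] < +oo)%E.

Definition separating_measure (Q : probability Omega R) (C : set L0) : Prop :=
  forall Y, C Y -> quasi_integrable Q Y /\ ('E_Q[Y] <= 0)%E.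

End spaces.
Arguments L0_ge0 {d Omega R} P.
Arguments Lp {d Omega R} P p.
Arguments Linfty_pos {d Omega R} P.

Section markets.
Context d (Omega : measurableType d) (R : realType) (P : probability Omega R).
Local Notation L0 := {mfun_ P, Omega >-> R}.
Variables (T n : nat) (F : nat -> set (set Omega)).
(* [X i t] is the price of asset [i] at time [t]; in the same way, [xi i t] is
   the [i]-th coordinate of the strategy at time [t]. *)
Variable X : 'I_n -> nat -> Omega -> R.

(* Measurability in R^n is measurability of all coordinates. *)
Definition strategy (xi : 'I_n -> nat -> Omega -> R) : Prop :=
  forall i t, (1 <= t <= T)%N -> measurable_wrt (F t.-1) (xi i t).

Definition gains (xi : 'I_n -> nat -> Omega -> R) (w : Omega) : R :=
  \sum_(1 <= t < T.+1) \sum_(i < n) xi i t w * (X i t w - X i t.-1 w).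

Definition K0 : set L0 :=
  [set Y : L0 | exists2 xi, strategy xi & Y = gains xi %[ae P]].

Definition NA : Prop := K0 `&` L0_ge0 P = [set L0_zero P].

Definition Ccone : set L0 := L0_setB K0 (L0_ge0 P) `&` Lp P 1%E.

Definition EMM (Q : probability Omega R) : Prop :=
  equivalent P Q /\ forall i, martingale Q T F (X i).

End markets.
Arguments K0 {d Omega R} P T {n} F X.
Arguments Ccone {d Omega R} P T {n} F X.

(* Main.v *)
(** The heart of the matter is the passage from no-arbitrage to a martingale
    measure with bounded density.

    Let [W] be the space of attainable gains.  Under no-arbitrage the cone of
    functions dominated by elements of [W] is closed under almost sure
    convergence.  One adds the traded increments one at a time, the latest ones
    first.  If [y_n <= xi_n h + w_n] with [y_n -> y], one multiplies by
    [1 / (1 + |xi_n|)] and passes to a measurably selected subsequence along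
    which [xi_n / (1 + |xi_n|)] tends to some [v]; closedness at the previous
    stage gives [(1 - |v|) y <= v h + w].  Where [|v| < 1] one divides by
    [1 - |v|]; where [|v| = 1] no-arbitrage forces [v h = - w], so that the
    increment [h] is redundant there.

    Then one minimizes [E[g u(f)]] over [f] in [W], where
    [u x = sqrt (1 + x ^ 2) - x] and [g] is a weight making prices
    square-integrable.  The loss [u] is convex with bounded, Lipschitz and
    negative derivative; the parallelogram-type inequality [loss_midpoint] shows
    that [- u'(f_n)] converges almost surely along a minimizing sequence [f_n],
    and the first-order condition passes to the limit [Z]: [E[g Z h] = 0] for
    [h] in [W].  On the event [Z = 0] the gains [f_n] tend to infinity, while
    their negative parts are bounded in mean, so that suitably rescaled gains
    dominate, in the limit, the indicator of this event: by closedness and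
    no-arbitrage it is negligible.  Hence [g Z], normalized, is a bounded
    positive martingale density. *)

Require Import Defs.
From HB Require Import structures.
From mathcomp Require Import all_boot all_order all_algebra.
From mathcomp Require Import all_classical all_reals all_analysis.
From mathcomp Require Import measurable_realfun ess_sup_inf.
From mathcomp Require Import ring lra.
Set Implicit Arguments.
Unset Strict Implicit.
Unset Printing Implicit Defensive.
Import Order.TTheory GRing.Theory Num.Theory.
Import numFieldNormedType.Exports.
Local Open Scope classical_set_scope.
Local Open Scope ring_scope.

(** * Measurable selection and dominated functions *)

(** The tail suprema decrease to the limit superior, and each of them is almost attained by a term
    of its own tail. *)
Lemma limn_sup_cluster (R : realType) (u : nat -> R) :
  has_ubound (range u) -> has_lbound (range u) ->
  forall e : R, 0 < e -> forall k, exists2 n, (k <= n)%N & `|u n - limn_sup u| < e.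
Proof.
move=> uub ulb e e0 k.
have e2 : 0 < e / 2 by rewrite divr_gt0.
have cu := cvg_sups_inf uub ulb.
have lE : limn_sup u = inf (range (sups u)) by apply: cvg_lim cu.
have /cvgrPdist_lt/(_ _ e2) [m _ mP] := cu.
have [m1 k1] := (leq_maxl m k, leq_maxr m k).
set p := maxn m k in m1 k1.
have dsup : has_sup (sdrop u p).
  split; last exact: has_ubound_sdrop.
  by exists (u p), p => /=.

have [_ [n /= pn <-] nP] := sup_adherent e2 dsup.
exists n; first exact: leq_trans pn.
have un : u n <= sups u p.
  apply: ub_le_sup; first exact: has_ubound_sdrop.
  by exists n.
have := mP _ m1; rewrite -lE => /=; rewrite !ltr_norml.
move: nP un; rewrite /sups /= => nP un /andP[h1 h2].
by apply/andP; split; lra.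
Qed.

(** [v] is the limit superior and [tau k x] the least [n >= k] with [|u n x - v x| < 1 / (k + 1)];
    leastness makes each event [tau k x = j] a finite combination of measurable sets. [tau] need not
    increase in [k]: [k <= tau k x] is enough for limits along it. *)
Lemma measurable_cluster_selection d (T : measurableType d) (R : realType)
    (u : nat -> T -> R) :
  (forall n, measurable_fun setT (u n)) -> (forall n x, `|u n x| <= 1) ->
  exists v : T -> R, exists tau : nat -> T -> nat,
    [/\ measurable_fun setT v,
        forall k j, measurable [set x | tau k x = j],
        forall k x, (k <= tau k x)%N &
        forall x, (fun k => u (tau k x) x) @ \oo --> v x].
Proof.
move=> mu u1.
have ub x : has_ubound (range (u ^~ x)).
  by exists 1 => _ [n _ <-]; exact: le_trans (ler_norm _) (u1 n x).
have lb x : has_lbound (range (u ^~ x)).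
  by exists (-1) => _ [n _ <-]; have := u1 n x; rewrite ler_norml => /andP[].
pose v x := limn_sup (u ^~ x).
have mv : measurable_fun setT v by apply: measurable_fun_limn_sup.
pose near_v k n x := (k <= n)%N && (`|u n x - v x| < k.+1%:R^-1).
have near_ex k x : exists n, near_v k n x.
  have [n kn nP] := limn_sup_cluster (ub x) (lb x) (e := k.+1%:R^-1) ltac:(by rewrite invr_gt0) k.
  by exists n; rewrite /near_v kn.
have mnear k n : measurable [set x | near_v k n x].
  rewrite /near_v; have [kn|kn] := leqP k n; last first.
    by rewrite [X in measurable X](_ : _ = set0)//; apply/seteqP; split.
  rewrite -[X in measurable X]setTI.
  apply: (@measurable_fun_ltr _ _ _ setT (fun x => `|u n x - v x|) (cst _)) => //.
  apply: measurableT_comp => //; exact: measurable_funB.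
exists v, (fun k x => ex_minn (near_ex k x)); split => //.
- move=> k j.
  rewrite (_ : mkset _ = [set x | near_v k j x] `\` \bigcup_(i in `I_j) [set x | near_v k i x]).
    apply: measurableD => //; apply: fin_bigcup_measurable => // i _; exact: mnear.
  apply/seteqP; split => [x /= <-|x /= [xj xi]].
    case: ex_minnP => m nm mmin; split => // -[i /= im ni].
    by have := mmin _ ni; rewrite leqNgt im.
  case: ex_minnP => m nm mmin; apply/eqP; rewrite eqn_leq mmin//= leqNgt.
  by apply/negP => mj; apply: xi; exists m.
- by move=> k x; case: ex_minnP => m /andP[].
- move=> x; apply/cvgrPdist_lt => e e0.
  near=> k; case: ex_minnP => m /andP[_ mP] _; rewrite distrC; apply: (lt_trans mP).
  by near: k; exact: near_infty_natSinv_lt (PosNum e0).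
Unshelve. all: by end_near. Qed.

Section subalgebra.
Context d (T : measurableType d) (R : realType).
Implicit Types (G : set (set T)) (f : T -> R).

Lemma measurable_wrtS G G' f : G `<=` G' -> measurable_wrt G f ->
  measurable_wrt G' f.
Proof.
move=> GG' mf _ B mB.
have : G.-sigma.-measurable (setT `&` f @^-1` B) by exact: mf.
exact: sub_sigma_algebra2.
Qed.

Lemma measurable_wrt_measurable G f : G `<=` measurable -> measurable_wrt G f ->
  measurable_fun setT f.
Proof.
move=> Gm mf _ B mB.
have : G.-sigma.-measurable (setT `&` f @^-1` B) by exact: mf.
by apply: smallest_sub => //; exact: sigma_algebra_measurable.
Qed.

Lemma measurable_wrt_indic G A : G.-sigma.-measurable A ->
  measurable_wrt G (\1_A : T -> R).
Proof. exact: (@measurable_indic _ (g_sigma_algebraType G) R setT A). Qed.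

Lemma measurable_wrtM G f g : measurable_wrt G f -> measurable_wrt G g ->
  measurable_wrt G (f \* g).
Proof. exact: (@measurable_funM _ (g_sigma_algebraType G)). Qed.

Lemma measurable_wrtN G f : measurable_wrt G f -> measurable_wrt G (\- f).
Proof. exact: (@measurable_funN _ (g_sigma_algebraType G)). Qed.

End subalgebra.

(** * Closedness of the cone of dominated functions *)

Section dominated_closedness.
Context d (T : measurableType d) (R : realType) (P : {measure set T -> \bar R}).
Implicit Types (G : set (set T)) (W : set (T -> R)) (h y w : T -> R).

(** The cone [W - L^0_+] of claims that can be superhedged from [W], up to null sets. *)
Definition dominated W y := exists2 w, W w & {ae P, forall x, y x <= w x}.

Definition dominated_closed W := forall (y_ : nat -> T -> R) y,
  (forall n, dominated W (y_ n)) ->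
  {ae P, forall x, y_ ^~ x @ \oo --> y x} -> dominated W y.

(** The scalars are random: arbitrary [G]-measurable functions. This allows normalizing by
    [1 + |xi|] and pasting along [G]-measurable events. *)
Definition module_over G W :=
  [/\ W (cst 0), forall v w, W v -> W w -> W (v \+ w) &
      forall c w, measurable_wrt G c -> W w -> W (c \* w)].

Definition no_arbitrage W := forall w, W w ->
  {ae P, forall x, 0 <= w x} -> {ae P, forall x, w x = 0}.

Definition adjoin G h W : set (T -> R) := [set y | exists2 c, measurable_wrt G c &
  exists2 w, W w & y = (c \* h) \+ w].

Lemma dominatedD W y z : (forall v w, W v -> W w -> W (v \+ w)) ->
  dominated W y -> dominated W z -> dominated W (y \+ z).
Proof.
move=> WD [v Wv yv] [w Ww zw]; exists (v \+ w); first exact: WD.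
by move: yv zw; apply: filterS2 => x; exact: lerD.
Qed.

Lemma dominatedM G W c y : module_over G W -> measurable_wrt G c ->
  (forall x, 0 <= c x) -> dominated W y -> dominated W (c \* y).
Proof.
move=> [_ _ WM] mc c0 [w Ww yw]; exists (c \* w); first exact: WM.
by move: yw; apply: filterS => x; exact: ler_wpM2l.
Qed.

(** The functions cut off outside [tau < m] are finite sums of localized dominated functions; at
    each point they are eventually constant in [m], and closedness gives the limit. *)
Lemma dominated_pasting G W (y_ : nat -> T -> R) (tau : T -> nat) :
  module_over G W -> dominated_closed W ->
  (forall j, G.-sigma.-measurable [set x | tau x = j]) ->
  (forall n, dominated W (y_ n)) -> dominated W (fun x => y_ (tau x) x).
Proof.
move=> WG Wcl mtau Wy; have [W0 WD _] := WG.
apply: (Wcl (fun m x => if (tau x < m)%N then y_ (tau x) x else 0)).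
  elim => [|m IH]; first by exists (cst 0) => //; exact: aeW.
  have := dominatedM (c := \1_[set x | tau x = m]) WG (measurable_wrt_indic (mtau m)) _ (Wy m).
  move=> /(_ ltac:(by move=> x; rewrite indicE ler0n)) /(dominatedD WD IH).
  congr dominated; apply/funext => x /=; rewrite indicE (ltnS (tau x)) [(tau x <= m)%N]leq_eqVlt.
  have [<-|tm] := eqVneq (tau x) m.
    by rewrite ltnn mem_set//= mul1r add0r.
  rewrite memNset ?mul0r ?addr0//=; exact/eqP.
apply: aeW => x; apply: cvg_near_cst.
by exists (tau x).+1 => //= m /= ->.
Qed.

End dominated_closedness.

Section adjoin_closed.
Context d (T : measurableType d) (R : realType) (P : {measure set T -> \bar R}).
Variables (G : set (set T)) (h : T -> R) (W : set (T -> R)).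

Lemma dominated_closed_adjoin : module_over G W -> dominated_closed P W ->
  no_arbitrage P (adjoin G h W) -> dominated_closed P (adjoin G h W).
Proof.
move=> WG Wcl NA y_ y ydom ycv; have [W0 WD WM] := WG.
have /choice[p pP] : forall n, exists p : (T -> R) * (T -> R),
    [/\ measurable_wrt G p.1, W p.2 &
        {ae P, forall x, y_ n x <= p.1 x * h x + p.2 x}].
  by move=> n; have [_ [c mc [w Ww ->]] yn] := ydom n; exists (c, w).
pose xi n := (p n).1; pose w n := (p n).2.
have mxi n : measurable_wrt G (xi n) by have [] := pP n.
have Ww n : W (w n) by have [] := pP n.
have yw n : {ae P, forall x, y_ n x <= xi n x * h x + w n x} by have [] := pP n.
(* [r] is [1 / (1 + |xi|)], written as a power so that measurability follows by composition. By
   [rth] below it equals [1 - |th|], so its limit along [tau] is [1 - |v|]. *)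
pose r n x := (1 + `|xi n x|) `^ (-1).
pose th n x := xi n x * r n x.
have xi_gt0 n x : 0 < 1 + `|xi n x| by rewrite ltr_pwDl.
have rE n x : r n x = (1 + `|xi n x|)^-1 by rewrite /r powR_inv1// ltW.
have r_gt0 n x : 0 < r n x by rewrite rE invr_gt0.
have rth n x : r n x = 1 - `|th n x|.
  rewrite /th normrM (gtr0_norm (r_gt0 n x)) rE.
  by field; rewrite gt_eqF.
have th1 n x : `|th n x| <= 1 by rewrite -subr_ge0 -rth ltW.
have mr n : measurable_wrt G (r n).
  apply: (@measurableT_comp _ _ _ _ _ _ (fun a : R => a `^ (-1))) => //=.
  apply: measurable_funD => //; apply: measurableT_comp => //; exact: mxi.
have mth n : measurable_wrt G (th n) by exact: measurable_wrtM.
have [v [tau [mv mtau ktau cvtau]]] :=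
  measurable_cluster_selection (T := g_sigma_algebraType G) mth th1.
have v1 x : `|v x| <= 1.
  apply: (cvgr_to_le (cvg_norm (cvtau x))).
  by apply: nearW => k; exact: th1.
(* Multiplied by [r n], the bound on [y_ n] becomes [r y_n - th h <= r w_n], with right-hand side in
   [W]. Pasted along [tau], the left-hand side converges, and closedness of [W] applies. *)
have [w0 Ww0 w0P] : dominated P W (fun x => (1 - `|v x|) * y x - v x * h x).
  apply: (Wcl (fun k x => r (tau k x) x * y_ (tau k x) x - th (tau k x) x * h x)).
    move=> k.
    apply: (@dominated_pasting _ _ _ P G W
      (fun n x => r n x * y_ n x - th n x * h x) (tau k)) => // n.
    exists (r n \* w n); first exact: WM.
    apply: filterS (yw n) => x /(ler_wpM2l (ltW (r_gt0 n x))).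
    rewrite mulrDr lerBlDr /th /=; congr (_ <= _); ring.
  apply: filterS ycv => x yx; apply: cvgB; apply: cvgM.
  - rewrite (_ : (fun k => _) = (fun k => 1 - `|th (tau k x) x|)).
      by apply: cvgB; [exact: cvg_cst|exact: cvg_norm].
    by apply/funext => k; rewrite rth.
  - apply: (@cvg_comp _ _ _ (tau ^~ x) (y_ ^~ x) _ \oo) => //.
    by move=> A [N _ NA']; exists N => // k /= Nk; apply: NA'; exact: leq_trans (ktau k x).
  - exact: cvtau.
  - exact: cvg_cst.
pose S1 := [set x | `|v x| < 1].
have mS1 : G.-sigma.-measurable S1.
  rewrite -[X in measurable X]setTI.
  apply: (@measurable_fun_ltr _ (g_sigma_algebraType G) R setT
    (fun x => `|v x|) (cst 1)) => //.
  by apply: measurableT_comp => //; exact: mv.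
have mS2 : G.-sigma.-measurable (~` S1) by exact: measurableC.
have mi1 := measurable_wrt_indic (R := R) mS1.
have mi2 := measurable_wrt_indic (R := R) mS2.
have S2P x : ~ S1 x -> v x * v x = 1.
  move=> /negP; rewrite -leNgt => v1'.
  by rewrite -expr2 -real_normK ?num_real//; apply/eqP; rewrite sqrp_eq1// eq_le v1.
(* Where [|v| = 1] the bound just obtained reads [0 <= v h + w0]: localized to this event, it is a
   gain without loss. *)
have vh0 : {ae P, forall x, \1_(~` S1) x * (v x * h x + w0 x) = 0}.
  apply: NA.
    exists (\1_(~` S1) \* v); first exact: measurable_wrtM.
    exists (\1_(~` S1) \* w0); first exact: WM.
    by apply/funext => x /=; ring.
  apply: filterS w0P => x; rewrite indicE; case: (boolP (x \in _)) => [|_]; last by rewrite mul0r.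
  rewrite inE mul1r => /negP; rewrite -leNgt => v1'.
  rewrite (_ : `|v x| = 1) ?subrr ?mul0r ?sub0r; first by lra.
  by apply/eqP; rewrite eq_le v1.
(* Here [v v = 1], so [h = v (v h) = - v w0]: the increment is eliminated from the bounds on [y_ n],
   and closedness of [W] is used a second time. *)
have [w2 Ww2 w2P] : dominated P W (\1_(~` S1) \* y).
  apply: (Wcl (fun n => \1_(~` S1) \* y_ n)); last first.
    by apply: filterS ycv => x yx; apply: cvgM => //; exact: cvg_cst.
  move=> n; exists (\1_(~` S1) \* ((\- (xi n \* v)) \* w0 \+ w n)).
    apply: (WM) => //; apply: (WD) => //; apply: (WM) => //.
    by apply: measurable_wrtN; exact: measurable_wrtM.
  move: (yw n) vh0; apply: filterS2 => x /= + +.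
  rewrite indicE; case: (boolP (x \in _)) => [|_ _ _]; last by rewrite !mul0r.
  rewrite inE !mul1r => /S2P vv ynx vh.
  apply: (le_trans ynx); rewrite lerD2r.
  rewrite (_ : h x = v x * (v x * h x)); last by rewrite mulrA vv mul1r.
  have -> : v x * h x = - w0 x by lra.
  by rewrite le_eqVlt; apply/orP; left; apply/eqP; ring.
(* On [S1] division by [1 - |v|] is legitimate; elsewhere the indicator kills the factor and [w2]
   takes over. *)
pose c1 x := \1_S1 x * (1 - `|v x|) `^ (-1).
have mc1 : measurable_wrt G c1.
  apply: measurable_wrtM => //.
  apply: (@measurableT_comp _ _ _ _ _ _ (fun a : R => a `^ (-1))) => //=.
  by apply: measurable_funB => //; apply: measurableT_comp => //; exact: mv.
exists ((c1 \* v) \* h \+ ((c1 \* w0) \+ w2)).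
  exists (c1 \* v); first exact: measurable_wrtM.
  by exists ((c1 \* w0) \+ w2) => //; apply: WD => //; exact: WM.
move: w0P w2P; apply: filterS2 => x /= w0x.
rewrite indicE in_setC /c1 indicE; case: (boolP (x \in S1)) => /= [|_].
  rewrite inE /S1 /= -subr_gt0 => a0; rewrite !mul1r mul0r (powR_inv1 (ltW a0)) => w2x.
  have {}w0x : (1 - `|v x|) * y x <= v x * h x + w0 x by lra.
  have : y x <= (1 - `|v x|)^-1 * (v x * h x + w0 x).
    by rewrite mulrC ler_pdivlMr// mulrC.
  by rewrite mulrDr -!mulrA addrA => /le_trans; apply; rewrite lerDl.
by rewrite !mul0r !add0r mul1r.
Qed.

End adjoin_closed.

(** * Gains from finitely many successive trades *)

Section gain_span.
Context d (T : measurableType d) (R : realType) (P : {measure set T -> \bar R}).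
Context (I : eqType) (G_ : I -> set (set T)) (h_ : I -> T -> R).
Implicit Types (s : seq I) (k : I).

(** The fold adjoins the head last: with [s] in chronological order, the tail is the market of the
    later trades. *)
Definition gain_span s : set (T -> R) :=
  foldr (fun k => adjoin (G_ k) (h_ k)) [set cst 0] s.

Definition nested_algebras s := pairwise (fun k l => `[< G_ k `<=` G_ l >]) s.

(** Distinct indices allow a single family of coefficients: changing it at the head leaves the sum
    over the tail unchanged. *)
Lemma gain_spanP s y : uniq s -> gain_span s y <->
  exists2 c : I -> T -> R, (forall k, k \in s -> measurable_wrt (G_ k) (c k)) &
    y = fun x => \sum_(k <- s) c k x * h_ k x.
Proof.
elim: s y => [|k s IH] y /=.
  move=> _; split=> [->|[c _ ->]].
    by exists (fun=> cst 0) => //; apply/funext => x; rewrite big_nil.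
  by apply/funext => x; rewrite big_nil.
move=> /andP[ks us]; split => [[c0 mc0 [_ /(IH _ us)[c mc ->] ->]]|[c mc ->]].
  exists (fun l => if l == k then c0 else c l).
    move=> l; rewrite in_cons; have [->//|_/=] := eqVneq l k; exact: mc.
  apply/funext => x; rewrite big_cons eqxx; congr (_ + _).
  rewrite !big_seq; apply: eq_bigr => l ls.
  by have [lk|//] := eqVneq l k; rewrite -lk ls in ks.
exists (c k); first by apply: mc; rewrite mem_head.
exists (fun x => \sum_(l <- s) c l x * h_ l x).
  apply/(IH _ us); exists c => // l ls; apply: mc; rewrite in_cons ls; exact: orbT.
by apply/funext => x; rewrite big_cons.
Qed.

Lemma adjoin_sub G h (W : set (T -> R)) : W `<=` adjoin G h W.
Proof.
move=> w Ww; exists (cst 0); first exact: measurable_cst.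
by exists w => //; apply/funext => x /=; rewrite mul0r add0r.
Qed.

Lemma module_over_gain_span G s : (forall k, k \in s -> G `<=` G_ k) ->
  module_over G (gain_span s).
Proof.
elim: s => [|k s IH] Gs /=.
  split => // [v w -> ->|c w _ ->]; apply/funext => x /=.
    by rewrite addr0.
  by rewrite mulr0.
have [|W0 WD WM] := IH.
  by move=> l ls; apply: Gs; rewrite in_cons ls orbT.
split; first exact: adjoin_sub.
- move=> _ _ [c mc [v Wv ->]] [c' mc' [v' Wv' ->]].
  exists (c \+ c'); first exact: (@measurable_funD _ (g_sigma_algebraType (G_ k))).
  exists (v \+ v'); first exact: WD.
  by apply/funext => x /=; ring.
- move=> c _ mc [c' mc' [v' Wv' ->]]; exists (c \* c').
    apply: measurable_wrtM => //; apply: measurable_wrtS mc.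
    by apply: Gs; rewrite mem_head.
  exists (c \* v'); first exact: WM.
  by apply/funext => x /=; ring.
Qed.

(** Induction on [s]: the algebra of the head is contained in all later ones, so the span of the
    tail is a module over it, and the tail inherits absence of arbitrage. For the empty list, limits
    of nonpositive functions are nonpositive. *)
Lemma dominated_closed_gain_span s : nested_algebras s -> no_arbitrage P (gain_span s) ->
  dominated_closed P (gain_span s).
Proof.
elim: s => [|k s IH] /=.
  move=> _ _ y_ y ydom ycv; exists (cst 0) => //.
  have /ae_foralln : forall n, {ae P, forall x, y_ n x <= 0}.
    by move=> n; have [_ -> /=] := ydom n.
  move: ycv; apply: filterS2 => x yx y0.
  by apply: (cvgr_to_le yx); apply: nearW => n; exact: y0.
move=> /andP[/allP ks ns] NA.
apply: dominated_closed_adjoin => //.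
  by apply: module_over_gain_span => l /ks /asboolP.
by apply: IH => // w Ww; apply: NA; exact: adjoin_sub.
Qed.

End gain_span.

(** * The loss function *)

Section utility.
Context {R : realType}.
Implicit Types x y e M : R.

Definition sqrt1sq x := Num.sqrt (1 + x ^+ 2).

Definition loss x := sqrt1sq x - x.

(** Minus the derivative of [loss]. *)
Definition slope x := 1 - x / sqrt1sq x.

Lemma sqrt1sqX x : sqrt1sq x ^+ 2 = 1 + x ^+ 2.
Proof. by rewrite sqr_sqrtr// addr_ge0// sqr_ge0. Qed.

Lemma sqrt1sq_ge1 x : 1 <= sqrt1sq x.
Proof. by rewrite -[leLHS]sqrtr1 ler_wsqrtr// lerDl sqr_ge0. Qed.

Lemma sqrt1sq_gt0 x : 0 < sqrt1sq x.
Proof. exact: lt_le_trans (sqrt1sq_ge1 x). Qed.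

Lemma norm_lt_sqrt1sq x : `|x| < sqrt1sq x.
Proof. by rewrite -sqrtr_sqr ltr_sqrt ?ltrDr// ltr_pwDl// sqr_ge0. Qed.

Lemma loss_ge0 x : 0 <= loss x.
Proof. by rewrite subr_ge0; exact/ltW/(le_lt_trans (ler_norm x))/norm_lt_sqrt1sq. Qed.

Lemma oppr_le_loss x : - x <= loss x.
Proof. by rewrite lerDr ltW// sqrt1sq_gt0. Qed.

Lemma loss0 : loss 0 = 1.
Proof. by rewrite /loss /sqrt1sq expr0n/= addr0 sqrtr1 subr0. Qed.

(** The second derivative of [loss] is at most [1]; algebraically this is [2 s t <= s^2 + t^2] with
    [t^2 = s^2 + 2 x e + e^2]. *)
Lemma loss_descent x e : loss (x + e) <= loss x - slope x * e + e ^+ 2 / 2.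
Proof.
rewrite /loss /slope; set s := sqrt1sq x; set t := sqrt1sq (x + e).
have s1 : 1 <= s := sqrt1sq_ge1 x.
have s0 : s != 0 by rewrite gt_eqF ?sqrt1sq_gt0.
have tE : t ^+ 2 = s ^+ 2 + 2 * x * e + e ^+ 2 by rewrite !sqrt1sqX; ring.
have st : t <= s + x / s * e + e ^+ 2 / 2 / s.
  rewrite (_ : s + _ + _ = (t ^+ 2 + s ^+ 2) / (2 * s)); last first.
    by rewrite tE; field.
  rewrite ler_pdivlMr; last by rewrite mulr_gt0 ?sqrt1sq_gt0.
  by have := sqr_ge0 (t - s); lra.
have : e ^+ 2 / 2 / s <= e ^+ 2 / 2.
  by rewrite ler_pdivrMr ?sqrt1sq_gt0// ler_peMr// divr_ge0// sqr_ge0.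
by lra.
Qed.

(** With [N = s t - 1 - x y], nonnegative by Cauchy-Schwarz, the convexity gap [D = s + t - 2 r]
    satisfies [D (s + t + 2 r) = 2 N], while the squared difference of slopes is
    [2 N / (s t) - (1 / s - 1 / t)^2]. Finally [s + t + 2 r <= 4 s t]. *)
Lemma loss_midpoint x y :
  2 * loss ((x + y) / 2) + (slope x - slope y) ^+ 2 / 4 <= loss x + loss y.
Proof.
rewrite /loss /slope.
set s := sqrt1sq x; set t := sqrt1sq y; set r := sqrt1sq _.
have s1 : 1 <= s := sqrt1sq_ge1 x.
have t1 : 1 <= t := sqrt1sq_ge1 y.
have r1 : 1 <= r := sqrt1sq_ge1 _.
have sE : s ^+ 2 = 1 + x ^+ 2 := sqrt1sqX x.
have tE : t ^+ 2 = 1 + y ^+ 2 := sqrt1sqX y.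
have rE : 4 * r ^+ 2 = 4 + (x + y) ^+ 2 by rewrite sqrt1sqX; field.
have s0 : s != 0 by rewrite gt_eqF ?sqrt1sq_gt0.
have t0 : t != 0 by rewrite gt_eqF ?sqrt1sq_gt0.
set N := s * t - 1 - x * y.
have N0 : 0 <= N.
  have : (1 + x * y) ^+ 2 <= (s * t) ^+ 2.
    by rewrite exprMn sE tE -subr_ge0 (_ : _ - _ = (x - y) ^+ 2) ?sqr_ge0//; ring.
  rewrite -[X in X <= _]real_normK ?num_real// ler_sqr ?nnegrE ?mulr_ge0 ?sqrtr_ge0//.
  by have := ler_norm (1 + x * y); rewrite /N; lra.
set D := s + t - 2 * r.
have gap : D * (s + t + 2 * r) = 2 * N.
  have -> : D * (s + t + 2 * r) = s ^+ 2 + t ^+ 2 + 2 * (s * t) - 4 * r ^+ 2.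
    by rewrite /D; ring.
  by rewrite rE sE tE /N; ring.
have D0 : 0 <= D.
  by rewrite -(@pmulr_lge0 _ (s + t + 2 * r)) ?gap; lra.
have qE : (1 - x / s - (1 - y / t)) ^+ 2 <= 2 * N / (s * t).
  rewrite -subr_ge0 (_ : _ - _ = (s^-1 - t^-1) ^+ 2) ?sqr_ge0//; apply/eqP.
  rewrite -subr_eq0 (_ : _ - _ = (2 * s ^+ 2 * t ^+ 2 - t ^+ 2 * (1 + x ^+ 2) -
    s ^+ 2 * (1 + y ^+ 2)) / (s ^+ 2 * t ^+ 2)).
    by rewrite -sE -tE (_ : _ - _ = 0) ?mul0r//; ring.
  by rewrite /N; field; rewrite s0 t0.
have st4 : s + t + 2 * r <= 4 * (s * t).
  have : 0 <= (s - 1) * (t - 1) by rewrite mulr_ge0// subr_ge0.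
  have := ler_wpM2l (ltW (lt_le_trans ltr01 s1)) t1.
  have := ler_wpM2r (ltW (lt_le_trans ltr01 t1)) s1.
  by move: D0; rewrite /D; lra.
have : 2 * N / (s * t) / 4 <= D.
  rewrite ler_pdivrMr// ler_pdivrMr ?mulr_gt0 ?sqrt1sq_gt0//.
  by rewrite -gap -mulrA ler_wpM2l.
by rewrite /D; lra.
Qed.

Lemma slope_gt0 x : 0 < slope x.
Proof.
rewrite subr_gt0 ltr_pdivrMr ?sqrt1sq_gt0// mul1r.
exact: le_lt_trans (ler_norm x) (norm_lt_sqrt1sq x).
Qed.

Lemma slope_le2 x : slope x <= 2.
Proof.
have := norm_lt_sqrt1sq x; rewrite ltr_norml => /andP[h _].
have : -1 <= x / sqrt1sq x by rewrite ler_pdivlMr ?sqrt1sq_gt0// mulN1r ltW.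
by rewrite /slope; lra.
Qed.

(** For [x > 0] the slope is [1 / (s (s + x))] with [s = sqrt1sq x <= 1 + M]. Used in contrapositive
    form: slopes tending to [0] force the gains to infinity. *)
Lemma slope_ge x M : 0 <= M -> x <= M -> ((1 + M) * (1 + 2 * M))^-1 <= slope x.
Proof.
move=> M0 xM; have s0 := sqrt1sq_gt0 x; have s1 := sqrt1sq_ge1 x.
have M1 : ((1 + M) * (1 + 2 * M))^-1 <= 1 by rewrite invf_le1; nra.
have [x0|x0] := leP x 0.
  apply: (le_trans M1); rewrite /slope lerBrDr -lerBrDl subrr.
  by rewrite pmulr_lle0// invr_gt0.
have sx : 0 < sqrt1sq x + x by rewrite addr_gt0.
have -> : slope x = (sqrt1sq x * (sqrt1sq x + x))^-1.
  rewrite /slope; have := sqrt1sqX x; set s := sqrt1sq x in s0 s1 sx * => sE.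
  apply/eqP; rewrite -subr_eq0 (_ : _ - _ = (s ^+ 2 - x ^+ 2 - 1) / (s * (s + x))).
    by rewrite sE addrK subrr mul0r.
  by field; rewrite !gt_eqF.
have sM : sqrt1sq x <= 1 + M.
  rewrite -[leRHS]ger0_norm; last by rewrite addr_ge0.
  rewrite -sqrtr_sqr ler_wsqrtr//; nra.
rewrite lef_pV2 ?posrE ?mulr_gt0//; nra.
Qed.

Lemma measurable_sqrt1sq : measurable_fun setT sqrt1sq.
Proof.
apply: (@measurableT_comp _ _ _ _ _ _ (@Num.sqrt R)).
  by apply: continuous_measurable_fun; exact: sqrt_continuous.
apply: (@measurable_funD _ _ R setT (cst 1) (fun x => x ^+ 2)) => //.
Qed.

Lemma measurable_loss : measurable_fun setT loss.
Proof. by apply: measurable_funB => //; exact: measurable_sqrt1sq. Qed.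

Lemma measurable_slope : measurable_fun setT slope.
Proof.
rewrite (_ : slope = fun x => 1 - x * (sqrt1sq x) `^ (-1)); last first.
  by apply/funext => x; rewrite powR_inv1 ?ltW// sqrt1sq_gt0.
apply: measurable_funB => //; apply: measurable_funM => //.
apply: (@measurableT_comp _ _ _ _ _ _ (fun a : R => a `^ (-1))) => //.
exact: measurable_sqrt1sq.
Qed.

End utility.

(** * Minimization of the expected loss *)

Section ae_summability.
Context d (T : measurableType d) (R : realType) (mu : {measure set T -> \bar R}).

(** The bounds add up to [C], so by monotone convergence the sum of the series is integrable, hence
    finite almost everywhere. *)
Lemma ae_cvg_series (u : nat -> T -> R) (C : R) :
  (forall n, measurable_fun setT (u n)) -> (forall n x, 0 <= u n x) ->
  (forall n, (\int[mu]_x (u n x)%:E <= (C / (2 ^ n.+1)%:R)%:E)%E) ->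
  {ae mu, forall x, cvgn (series (u ^~ x))}.
Proof.
move=> mu_ u0 uC.
have C0 : 0 <= C.
  have : (0 <= (C / (2 ^ 1)%:R)%:E)%E.
    by apply: le_trans (uC 0%N); apply: integral_ge0 => x _; rewrite lee_fin.
  by rewrite lee_fin pmulr_lge0.
have mE n : measurable_fun setT (EFin \o u n) by exact/measurable_EFinP.
pose S x := (\sum_(n <oo) (u n x)%:E)%E.
have iS : mu.-integrable setT S.
  apply/integrableP; split.
    apply: (ge0_emeasurable_sum (P := xpredT) (h := fun n x => (u n x)%:E)) => [k x _ _|k _].
      by rewrite lee_fin.
    exact: mE.
  rewrite (eq_integral S); last first.
    by move=> x _; rewrite gee0_abs// nneseries_ge0// => n _ _; rewrite lee_fin.
  rewrite integral_nneseries//; last by move=> n x _; rewrite lee_fin.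
  apply: (@le_lt_trans _ _ C%:E); last exact: ltry.
  apply: le_trans (epsilon_trick0 xpredT C0).
  apply: lee_nneseries => [n _ _|n _]; last exact: uC.
  by apply: integral_ge0 => x _; rewrite lee_fin.
apply: filterS (integrable_ae measurableT iS) => x /(_ I) Sx.
apply: nondecreasing_is_cvgn; first by apply: nondecreasing_series => *; exact: u0.
exists (fine (S x)) => _ [n _ <-].
rewrite -lee_fin fineK// /series/= -sumEFin.
by apply: nneseries_lim_ge => k _ _; rewrite lee_fin.
Qed.

Lemma bounded_integrable (P : probability T R) (f : T -> R) (C : R) :
  measurable_fun setT f -> (forall x, `|f x| <= C) ->
  P.-integrable setT (EFin \o f).
Proof.
move=> mf fC; apply: (@le_integrable _ _ _ P setT _ _ (EFin \o cst C)) => //.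
- exact/measurable_EFinP.
- by move=> x _ /=; rewrite lee_fin (le_trans (fC x))// ler_norm.
- exact: finite_measure_integrable_cst.
Qed.

End ae_summability.

Section utility_minimization.
Context d (T : measurableType d) (R : realType) (P : probability T R).
Context (g : T -> R) (W : set (T -> R)).
Context (mg : measurable_fun setT g) (g_gt0 : forall x, 0 < g x)
  (g_le1 : forall x, g x <= 1).
Context (mW : forall w, W w -> measurable_fun setT w) (W0 : W (cst 0))
  (WD : forall v w, W v -> W w -> W (v \+ w))
  (WZ : forall a w, W w -> W (fun x => a * w x)).

Let Phi (f : T -> R) : \bar R := (\int[P]_x (g x * loss (f x))%:E)%E.

Let m := ereal_inf (Phi @` W).

Let mgloss (f : T -> R) : measurable_fun setT f ->
  measurable_fun setT (fun x => g x * loss (f x)).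
Proof.
move=> mf; apply: measurable_funM => //.
exact: (measurableT_comp (@measurable_loss R)).
Qed.

Let mslope (f : T -> R) : measurable_fun setT f -> measurable_fun setT (fun x => slope (f x)).
Proof. by move=> mf; exact: (measurableT_comp (@measurable_slope R)). Qed.

Let gloss_ge0 x y : 0 <= g x * loss y.
Proof. by rewrite mulr_ge0 ?loss_ge0// ltW. Qed.

Let Phi_ge0 f : (0 <= Phi f)%E.
Proof. by apply: integral_ge0 => x _; rewrite lee_fin. Qed.

Let m_ge0 : (0 <= m)%E.
Proof. by apply: le_ereal_inf_tmp => _ [w _ <-]. Qed.

Let m_le w : W w -> (m <= Phi w)%E.
Proof. by move=> Ww; apply: ereal_inf_lbound; exists w. Qed.

Let m_le1 : (m <= 1)%E.
Proof.
apply: le_trans (m_le W0) _; rewrite -(@probability_setT _ _ _ P).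
rewrite -[leRHS]mul1e -integral_cst//; apply: ge0_le_integral => //.
- by move=> x _; rewrite lee_fin.
- by apply/measurable_EFinP/mgloss; exact: measurable_cst.
- by move=> x _ /=; rewrite loss0 mulr1 lee_fin.
Qed.

Let m_fin : m \is a fin_num.
Proof. by rewrite ge0_fin_numE// (le_lt_trans m_le1)// ltry. Qed.

(** [loss_midpoint] integrated against [g]: the midpoint of [v] and [w] is again in [W], so its
    expected loss is at least [m]. *)
Let gap v w : W v -> W w ->
  (2%:E * m + \int[P]_x (g x * (slope (v x) - slope (w x)) ^+ 2 / 4)%:E <=
   Phi v + Phi w)%E.
Proof.
move=> Wv Ww; have [mv mw] := (mW Wv, mW Ww).
have Wmid : W (fun x => 2^-1 * (v x + w x)) by apply: WZ; exact: WD.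
have h : (2%:E * m <= 2%:E * Phi (fun x => (2^-1 * (v x + w x))%R))%E.
  by apply: lee_wpmul2l; [rewrite lee_fin|exact: m_le].
apply: le_trans (leeD h (lexx _)) _ => {h}.
have msq : measurable_fun setT (fun x => g x * (slope (v x) - slope (w x)) ^+ 2 / 4).
  apply: measurable_funM => //; apply: measurable_funM => //.
  by apply: measurable_funX; apply: measurable_funB; exact: mslope.
have mmid := mgloss (mW Wmid).
have mE (f : T -> R) : measurable_fun setT f -> measurable_fun setT (fun x => (f x)%:E).
  by move=> ?; exact/measurable_EFinP.
have sq0 x : 0 <= g x * (slope (v x) - slope (w x)) ^+ 2 / 4.
  by rewrite divr_ge0// mulr_ge0 ?sqr_ge0// ltW.
rewrite /Phi -ge0_integralZl_EFin//; last 2 first.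
- by move=> x _; rewrite lee_fin.
- exact: mE.
rewrite -[leRHS]ge0_integralD//; last 4 first.
- by move=> x _; rewrite lee_fin.
- by apply/mE/mgloss.
- by move=> x _; rewrite lee_fin.
- by apply/mE/mgloss.
rewrite -ge0_integralD//; last 4 first.
- by move=> x _; rewrite -EFinM lee_fin; apply: mulr_ge0 => //; exact: gloss_ge0.
- by apply: (mE (fun x => 2 * _)); exact: measurable_funM.
- by move=> x _; rewrite lee_fin.
- exact: mE.
apply: ge0_le_integral => //=.
- by move=> x _; rewrite -EFinM -EFinD lee_fin; apply: addr_ge0 => //; exact: mulr_ge0.
- apply: (mE (fun x => 2 * _ + _)); apply: measurable_funD => //.
  exact: measurable_funM.
- by apply: (mE (fun x => _ + _)); apply: measurable_funD; exact: mgloss.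
move=> x _; rewrite -EFinM -!EFinD lee_fin.
have := ler_wpM2l (ltW (g_gt0 x)) (loss_midpoint (v x) (w x)).
by rewrite [(v x + w x) / 2]mulrC; congr (_ <= _); ring.
Qed.

Let e n : R := (2 ^ n.+1)%:R^-1.

Let e_gt0 n : 0 < e n. Proof. by rewrite invr_gt0 ltr0n expn_gt0. Qed.

Let eS n : e n.+1 = e n / 2.
Proof. by rewrite /e [in LHS]expnS natrM invfM mulrC. Qed.

Let e_le1 n : e n <= 1.
Proof. by rewrite invf_le1 ?ltr0n ?ler1n expn_gt0. Qed.

Let e_cvg0 : e @ \oo --> (0 : R).
Proof.
rewrite (_ : e = fun n => (2^-1 : R) ^+ n.+1); last first.
  by apply/funext => n; rewrite /e natrX exprVn.
rewrite (cvg_shiftS (fun n => (2^-1 : R) ^+ n)).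
by apply: cvg_expr; rewrite ger0_norm// invf_lt1// ltr1n.
Qed.

(** The excess is the square of [e n]: differences of slopes are then of order [e n] in weighted
    [L^2], hence summable, and a perturbation of size [e n] has a cost of the same order as the
    excess. *)
Let near_minimizing (f : nat -> T -> R) :=
  forall n, W (f n) /\ (Phi (f n) <= m + (e n ^+ 2)%:E)%E.

Let near_minimizing_ex : exists f, near_minimizing f.
Proof.
suff : forall n, exists w, W w /\ (Phi w <= m + (e n ^+ 2)%:E)%E.
  by move=> /choice[f fP]; exists f.
move=> n; have e20 : 0 < e n ^+ 2 by rewrite exprn_gt0.
have [_ [w Ww <-] /ltW wP] := lb_ereal_inf_adherent e20 m_fin.
by exists w.
Qed.

Let Phi_fin f n : near_minimizing f -> Phi (f n) \is a fin_num.
Proof.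
move=> /(_ n)[_ fn]; rewrite ge0_fin_numE//; apply: le_lt_trans fn _.
by rewrite -(fineK m_fin) -EFinD ltry.
Qed.

(** [gap] makes successive slopes close in weighted [L^2], hence in weighted [L^1] with summable
    distances, so their increments are absolutely summable almost everywhere. *)
Let slope_cvg f : near_minimizing f ->
  {ae P, forall x, cvgn (fun n => slope (f n x))}.
Proof.
move=> fP; pose D n x := slope (f n.+1 x) - slope (f n x).
have mD n : measurable_fun setT (D n).
  by apply: measurable_funB; apply: mslope; apply: mW; exact: (fP _).1.
have intD2 n : (\int[P]_x (g x * D n x ^+ 2 / 4)%:E <= (2 * e n ^+ 2)%:E)%E.
  have := gap (fP n.+1).1 (fP n).1.
  have := leeD (fP n.+1).2 (fP n).2; move=> /[swap] /le_trans /[apply].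
  rewrite -(fineK m_fin); set J := integral _ _ _ => h.
  have {}h : ((2 * fine m)%:E + J <= (2 * fine m)%:E + (2 * e n ^+ 2)%:E)%E.
    rewrite EFinM; apply: (le_trans h).
    rewrite -EFinM -!EFinD lee_fin eS expr_div_n.
    by have := sqr_ge0 (e n); lra.
  by rewrite leeD2lE in h.
have : {ae P, forall x, cvgn (series (fun n => g x * `|D n x|))}.
  (* The constant is [9 = 1 + 4 * 2]: in [|D| <= e + D^2 / e] the last term is [4 / e] times the
     integrand of [intD2]. *)
  apply: (@ae_cvg_series _ _ _ P (fun n x => g x * `|D n x|) 9).
  - by move=> n; apply: measurable_funM => //; exact: measurableT_comp.
  - by move=> n x; rewrite mulr_ge0// ltW.
  move=> n; rewrite -/(e n).
  apply: (@le_trans _ _ (\int[P]_x ((e n)%:E + (4 / e n)%:E * (g x * D n x ^+ 2 / 4)%:E)%E)%E).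
    apply: ge0_le_integral => //.
    - by move=> x _; rewrite lee_fin mulr_ge0// ltW.
    - apply/measurable_EFinP.
      by apply: measurable_funM => //; exact: measurableT_comp.
    - apply/measurable_EFinP; apply: measurable_funD => //.
      apply: measurable_funM => //; apply: measurable_funM => //.
      by apply: measurable_funM => //; exact: measurable_funX.
    move=> x _; rewrite -EFinM -EFinD lee_fin.
    rewrite (_ : 4 / e n * _ = g x * (D n x ^+ 2 / e n)); last by field; rewrite gt_eqF.
    (* [|D| <= e + D^2 / e], and [g <= 1] *)
    have h : `|D n x| <= e n + D n x ^+ 2 / e n.
      rewrite -(@ler_pM2r _ (e n))// mulrDl divfK ?gt_eqF//.
      rewrite -[D n x ^+ 2]real_normK ?num_real//.
      have := sqr_ge0 (`|D n x| - e n); have := normr_ge0 (D n x).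
      by have := e_gt0 n; nra.
    apply: le_trans (ler_wpM2l (ltW (g_gt0 x)) h) _.
    by rewrite mulrDr lerD2r ler_piMl// ltW.
  have mgD : measurable_fun setT (fun x => (g x * D n x ^+ 2 / 4)%:E).
    apply/measurable_EFinP; apply: measurable_funM => //.
    by apply: measurable_funM => //; exact: measurable_funX.
  have gD0 x : (0 <= (g x * D n x ^+ 2 / 4)%:E)%E.
    by rewrite lee_fin divr_ge0// mulr_ge0 ?sqr_ge0// ltW.
  have en0 := ltW (e_gt0 n).
  rewrite ge0_integralD//; last 2 first.
  - by move=> x _; rewrite mule_ge0// lee_fin divr_ge0.
  - exact: emeasurable_funM.
  rewrite integral_cst//= (@probability_setT _ _ _ P) mule1 ge0_integralZl_EFin// ?divr_ge0//.
  apply: (@le_trans _ _ ((e n)%:E + (4 / e n)%:E * (2 * e n ^+ 2)%:E)%E).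
    by apply: leeD => //; apply: lee_wpmul2l => //; rewrite lee_fin divr_ge0.
  rewrite -EFinM -EFinD lee_fin le_eqVlt; apply/orP; left; apply/eqP.
  by field; rewrite gt_eqF.
apply: filterS => x /(is_cvg_seriesZ (k := (g x)^-1)) cD.
have : cvgn (series (telescope (fun n => slope (f n x)))).
  apply: normed_cvg.
  rewrite (_ : [normed series _] = series ((g x)^-1 *: (fun n => g x * `|D n x|)))//.
  apply/funext => n; rewrite /series /=; apply: eq_bigr => k _.
  rewrite [RHS](_ : _ = (g x)^-1 * (g x * `|D k x|))//.
  by rewrite mulrA mulVf ?mul1r// gt_eqF.
rewrite telescopeK => /cvg_ex[l hl]; apply/cvg_ex; exists (slope (f 0%N x) + l).
rewrite (_ : (fun n => _) = (fun n => slope (f 0%N x) +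
    (slope (f n x) - slope (f 0%N x)))); last first.
  by apply/funext => n; rewrite addrC subrK.
by apply: cvgD => //; exact: cvg_cst.
Qed.

(** The loss at [f n + t h] cannot go below [m], so by [loss_descent] the directional derivative
    satisfies [t a_n <= e_n^2 + t^2 C / 2] and tends to [0]; dominated convergence then replaces the
    slopes by [Z]. The bound on [g |h|] gives the domination, the bound on [g h^2] controls the
    quadratic term. *)
Let first_order f (Z h : T -> R) C : near_minimizing f -> measurable_fun setT Z ->
  {ae P, forall x, (fun n => slope (f n x)) @ \oo --> Z x} -> W h ->
  (forall x, g x * `|h x| <= C) -> (forall x, g x * h x ^+ 2 <= C) ->
  (\int[P]_x (g x * Z x * h x)%:E = 0)%E.
Proof.
move=> fP mZ fZ Wh hC h2C.
have mf n : measurable_fun setT (f n) by apply: mW; exact: (fP n).1.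
have mh := mW Wh.
have mgsh n : measurable_fun setT (fun x => g x * slope (f n x) * h x).
  by apply: measurable_funM => //; apply: measurable_funM => //; exact: mslope.
have gshC n x : `|g x * slope (f n x) * h x| <= 2 * C.
  rewrite !normrM (gtr0_norm (g_gt0 x)) (gtr0_norm (slope_gt0 _)).
  rewrite mulrAC mulrC; apply: ler_pM => //; last exact: slope_le2.
  - exact/ltW/slope_gt0.
  - by rewrite mulr_ge0// ltW.
have igsh n := bounded_integrable P (mgsh n) (gshC n).
pose a n := fine (\int[P]_x (g x * slope (f n x) * h x)%:E).
have aE n : (\int[P]_x (g x * slope (f n x) * h x)%:E = (a n)%:E)%E.
  by rewrite fineK//; exact: (integrable_fin_num measurableT (igsh n)).
have igl n : P.-integrable setT (EFin \o (fun x => g x * loss (f n x))).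
  apply/integrableP; split; first exact/measurable_EFinP/mgloss.
  under eq_integral do rewrite gee0_abs ?lee_fin//.
  by have := Phi_fin n fP; rewrite ge0_fin_numE.
have perturb n t : t * a n <= e n ^+ 2 + t ^+ 2 * (C / 2).
  have Wt : W (f n \+ (fun x => t * h x)) by apply: WD; [exact: (fP n).1|exact: WZ].
  have : (m <= \int[P]_x (g x * loss (f n x) - t * (g x * slope (f n x) * h x)
                           + t ^+ 2 * (C / 2))%:E)%E.
    have ub x : g x * loss ((f n \+ (fun x => t * h x)) x) <=
      g x * loss (f n x) - t * (g x * slope (f n x) * h x) + t ^+ 2 * (C / 2).
      apply: le_trans (ler_wpM2l (ltW (g_gt0 x)) (loss_descent _ _)) _.
      have := ler_wpM2l (divr_ge0 (sqr_ge0 t) (ltW (ltr0Sn R 1))) (h2C x).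
      by lra.
    apply: le_trans (m_le Wt) _; apply: ge0_le_integral => //.
    - by move=> x _; rewrite lee_fin.
    - by apply/measurable_EFinP/mgloss; exact: mW.
    - apply/measurable_EFinP; apply: measurable_funD => //.
      apply: measurable_funB; first exact: mgloss.
      exact: measurable_funM.
    - by move=> x _; rewrite lee_fin.
  pose F1 x := g x * loss (f n x); pose F2 x := g x * slope (f n x) * h x.
  have iF2 : P.-integrable setT (EFin \o (fun x => t * F2 x)).
    by apply: eq_integrable (integrableZl measurableT t (igsh n)).
  have iF3 : P.-integrable setT (EFin \o (fun x => - (t * F2 x) + t ^+ 2 * (C / 2))).
    apply: eq_integrable (integrableD measurableT (integrableN iF2)
      (finite_measure_integrable_cst P (t ^+ 2 * (C / 2)) measurableT)) => //.
  have -> : (\int[P]_x (g x * loss (f n x) - t * (g x * slope (f n x) * h x)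
      + t ^+ 2 * (C / 2))%:E = (fine (Phi (f n)) - t * a n + t ^+ 2 * (C / 2))%:E)%E.
    under eq_integral do rewrite -addrA.
    rewrite (integralD_EFin measurableT (igl n) iF3)/=.
    rewrite -[fine _ - _ + _]addrA [RHS]EFinD fineK ?Phi_fin//; congr adde.
    rewrite (integralD_EFin measurableT (f1 := fun x => - (t * F2 x))
      (f2 := cst (t ^+ 2 * (C / 2)))); last 2 first.
    - by apply: eq_integrable (integrableN iF2).
    - exact: finite_measure_integrable_cst.
    rewrite [RHS]EFinD; congr adde; last first.
      transitivity (\int[P]_x (cst (t ^+ 2 * (C / 2))%:E x))%E => //.
      by rewrite integral_cst//= (@probability_setT _ _ _ P) mule1.
    rewrite -mulNr EFinM -aE -(integralZl measurableT (igsh n))/=.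
    by apply: eq_integral => x _; rewrite -EFinM mulNr.
  rewrite -(fineK m_fin) lee_fin.
  have := (fP n).2; rewrite -(fineK m_fin) -(fineK (Phi_fin n fP)) -EFinD lee_fin.
  by lra.
(* Taking [t = e n] and [t = - e n] balances the two terms; dividing by [e n] leaves a bound of
   order [e n]. *)
have aC n : `|a n| <= e n * (1 + C / 2).
  have := perturb n (e n); have := perturb n (- e n).
  rewrite sqrrN mulNr => h1 h2.
  rewrite ler_norml -(ler_pM2l (e_gt0 n)) -(ler_pM2l (e_gt0 n) (a n)).
  by apply/andP; split; lra.
have a0 : a @ \oo --> (0 : R).
  apply/norm_cvg0P; apply: (squeeze_cvgr (f := cst 0) (h := fun n => e n * (1 + C / 2))).
  - by apply: nearW => n; rewrite normr_ge0 aC.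
  - exact: cvg_cst.
  - by rewrite -[X in _ --> X](mul0r (1 + C / 2)); apply: cvgM => //; exact: cvg_cst.
have mgs n : measurable_fun setT (fun x => (g x * slope (f n x) * h x)%:E).
  exact/measurable_EFinP.
have mgZ : measurable_fun setT (fun x => (g x * Z x * h x)%:E).
  by apply/measurable_EFinP; apply: measurable_funM => //; exact: measurable_funM.
have [|||_ _] := dominated_convergence measurableT mgs mgZ (g := EFin \o cst (2 * C)) (mu := P).
- apply: filterS fZ => x fZx _; apply: cvg_EFin; first exact: nearW.
  by apply: cvgM; [apply: cvgM => //|]; exact: cvg_cst.
- exact: finite_measure_integrable_cst.
- by apply: aeW => x n _; rewrite lee_fin.
move=> cvI; apply: (@cvg_unique _ _ _ _ _ _ cvI).
  exact: ereal_hausdorff.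
rewrite (_ : [sequence _]_n = EFin \o a); last by apply/funext => n; exact: aE.
by apply: cvg_EFin => //; exact: nearW.
Qed.

(** With [B] the event [Z <= 0], the index [n_ k] is chosen so that the gain is at least [2^k] on
    [B] outside a set of probability at most [e k]. By Borel-Cantelli the gains scaled by [2^-k] are
    eventually at least [1] almost everywhere on [B]. *)
Let slope_limit_gt0 f (Z : T -> R) : dominated_closed P W -> no_arbitrage P W ->
  near_minimizing f -> measurable_fun setT Z ->
  {ae P, forall x, (fun n => slope (f n x)) @ \oo --> Z x} ->
  {ae P, forall x, 0 < Z x}.
Proof.
move=> Wcl NA fP mZ fZ.
have mf n : measurable_fun setT (f n) by apply: mW; exact: (fP n).1.
pose B := [set x | Z x <= 0].
have mB : measurable B.
  rewrite -[B]setTI.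
  exact: (@measurable_fun_ler _ _ R setT Z (cst 0)).
(* on [B] the slopes tend to [0], so the payoffs tend to infinity *)
have fy x : (fun n => slope (f n x)) @ \oo --> Z x -> B x ->
    forall M, 0 <= M -> \forall n \near \oo, M < f n x.
  move=> fZx Zx M M0; pose b := ((1 + M) * (1 + 2 * M))^-1.
  have b0 : 0 < b by rewrite invr_gt0 mulr_gt0//; lra.
  have := fZx; move/cvgr_lt => /(_ b (le_lt_trans Zx b0)).
  apply: filterS => n; rewrite !ltNge; apply: contra => fM.
  exact: slope_ge.
pose A k n := B `&` [set x | f n x < (2 ^ k)%:R].
have mA k n : measurable (A k n).
  apply: measurableI => //; rewrite -[X in measurable X]setTI.
  exact: (@measurable_fun_ltr _ _ R setT (f n) (cst _)).
have /choice[n_ n_P] : forall k, exists n, (P (A k n) <= (e k)%:E)%E.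
  move=> k.
  have m1A n : measurable_fun setT (fun x => (\1_(A k n) x)%:E : \bar R).
    by apply/measurable_EFinP; exact: measurable_indic.
  have [||| _ _] := dominated_convergence measurableT m1A (measurable_cst 0%E)
      (g := EFin \o cst 1) (mu := P).
  - apply: filterS fZ => x fZx _.
    have [Bx|Bx] := pselect (B x).
      apply: cvg_near_cst.
      apply: filterS (fy x fZx Bx (2 ^ k)%:R (ler0n _ _)) => n fn.
      by rewrite indicE memNset// => -[_ /=]; rewrite ltNge (ltW fn).
    rewrite (_ : (fun n => _) = cst 0%E); first exact: cvg_cst.
    by apply/funext => n; rewrite indicE memNset// => -[].
  - exact: finite_measure_integrable_cst.
  - apply: aeW => x n _ /=; rewrite lee_fin ger0_norm indicE ?ler0n//.
    by case: (x \in _).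
  rewrite integral0 => /fine_cvgP[_] /cvgr_lt => /(_ (e k) (e_gt0 k)) [N _].
  move=> /(_ N (leqnn N)) /=; rewrite integral_indic// setIT => Ne.
  exists N; rewrite -(fineK (fin_num_measure P _ (mA k N))) lee_fin; exact: ltW.
have cA : {ae P, forall x, cvgn (series (fun k => \1_(A k (n_ k)) x : R))}.
  apply: (ae_cvg_series (C := 1)).
  - by move=> k; exact: measurable_indic.
  - by move=> k x; rewrite indicE ler0n.
  - by move=> k; rewrite integral_indic// setIT div1r; exact: n_P.
pose fneg k x := Num.max 0 (- f (n_ k) x).
have mfneg k : measurable_fun setT (fneg k).
  apply: measurable_maxr => //; exact: measurable_funN.
have fneg0 k x : 0 <= fneg k x by rewrite le_max lexx.
(* [loss] dominates the negative part, and [Phi (f n)] is at most [2] because [m <= 1] and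
   [e n <= 1]. With the scaling [2^-k], which is twice [e k], this gives the constant [4]. *)
have cneg : {ae P, forall x, cvgn (series (fun k => g x * fneg k x * (e k * 2)))}.
  apply: (@ae_cvg_series _ _ _ P (fun k x => g x * fneg k x * (e k * 2)) 4).
  - move=> k; apply: measurable_funM => //; exact: measurable_funM.
  - by move=> k x; rewrite !mulr_ge0// ltW.
  move=> k; rewrite -/(e k).
  apply: (@le_trans _ _ ((e k * 2)%:E * Phi (f (n_ k)))%E).
    rewrite /Phi -ge0_integralZl_EFin//; last 3 first.
    - by move=> x _; rewrite lee_fin.
    - by apply/measurable_EFinP; exact: mgloss.
    - by rewrite mulr_ge0// ltW.
    apply: ge0_le_integral => //.
    - by move=> x _; rewrite lee_fin !mulr_ge0// ltW.
    - apply/measurable_EFinP; apply: measurable_funM => //.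
      exact: measurable_funM.
    - apply/measurable_EFinP; apply: measurable_funM => //; exact: mgloss.
    move=> x _; rewrite -EFinM lee_fin [leLHS]mulrC; apply: ler_wpM2l.
      by rewrite mulr_ge0// ltW.
    apply: ler_wpM2l; first exact: ltW.
    by rewrite ge_max loss_ge0 oppr_le_loss.
  apply: (@le_trans _ _ ((e k * 2)%:E * 2%:E)%E).
    apply: lee_wpmul2l; first by rewrite lee_fin mulr_ge0// ltW.
    apply: le_trans (fP _).2 _.
    rewrite (_ : 2 = 1 + 1 :> R)// EFinD; apply: leeD => //.
    by rewrite lee_fin exprn_ile1// ltW.
  by rewrite -EFinM lee_fin; lra.
have WB : dominated P W \1_B.
  (* These minima lie below the scaled gains, which are in [W]. On [B] they are eventually [1]; off
     [B] they are minus the scaled negative parts, which tend to [0]. *)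
  apply: (Wcl (fun k x => Num.min (\1_B x) (e k * 2 * f (n_ k) x))).
    move=> k; exists (fun x => e k * 2 * f (n_ k) x).
      by apply: WZ; exact: (fP _).1.
    by apply: aeW => x; rewrite ge_min lexx orbT.
  move: cA cneg; apply: filterS2 => x /cvg_series_cvg_0 cA /cvg_series_cvg_0 cneg.
  have [Bx|Bx] := pselect (B x).
    apply: cvg_near_cst; rewrite indicE mem_set//=.
    move/cvgr_lt : cA => /(_ 1 ltr01); apply: filterS => k.
    rewrite indicE; case: (boolP (x \in _)) => [_|]; first by rewrite ltxx.
    rewrite notin_setE => xA _; apply/min_idPl.
    have : (2 ^ k)%:R <= f (n_ k) x by rewrite leNgt; apply/negP => ?; exact: xA.
    have -> : e k * 2 = (2 ^ k)%:R^-1 :> R.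
      by rewrite /e expnS natrM invfM mulrAC mulVf ?mul1r.
    by rewrite ler_pdivlMl ?ltr0n ?expn_gt0// mulr1.
  rewrite indicE memNset//= -[X in _ --> X](oppr0 R).
  rewrite (_ : (fun k => _) = (fun k => - ((g x)^-1 * (g x * fneg k x * (e k * 2))))).
    apply: cvgN; rewrite -[X in _ --> X](mulr0 (g x)^-1).
    by apply: cvgM => //; exact: cvg_cst.
  apply/funext => k; rewrite -[g x * _ * _]mulrA mulKf ?gt_eqF//.
  have : 0 < e k * 2 by rewrite mulr_gt0.
  rewrite /fneg; set c := e k * 2 => c0.
  have [f0|f0] := leP (f (n_ k) x) 0.
    rewrite min_r; first by rewrite max_r ?oppr_ge0// mulNr opprK mulrC.
    by rewrite pmulr_rle0.
  rewrite min_l; first by rewrite max_l ?mul0r ?oppr0// oppr_le0 ltW.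
  by rewrite mulr_ge0// ltW.
have [w Ww wP] := WB.
have w0 : {ae P, forall x, w x = 0}.
  apply: NA => //; apply: filterS wP => x; apply: le_trans.
  by rewrite indicE ler0n.
move: w0 wP; apply: filterS2 => x ->; rewrite indicE.
case: (boolP (x \in _)) => [_|]; first by rewrite ler10.
by rewrite notin_setE /B /= => /negP; rewrite -ltNge.
Qed.

(* [Z] is, up to the weight [g], the density of a martingale measure: it is the
   limit of minus the derivatives of the loss along a minimizing sequence. *)
Lemma positive_annihilator : dominated_closed P W -> no_arbitrage P W ->
  exists Z : T -> R, [/\ measurable_fun setT Z, forall x, 0 <= Z x <= 2,
    {ae P, forall x, 0 < Z x} &
    forall h C, W h -> (forall x, g x * `|h x| <= C) ->
      (forall x, g x * h x ^+ 2 <= C) ->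
      (\int[P]_x (g x * Z x * h x)%:E = 0)%E].
Proof.
move=> Wcl NA; have [f fP] := near_minimizing_ex.
have mf n : measurable_fun setT (f n) by apply: mW; exact: (fP n).1.
pose L x := limn_sup (fun n => slope (f n x)).
have mL : measurable_fun setT L.
  apply: (@measurable_fun_limn_sup _ _ _ setT (fun n x => slope (f n x))).
  - by move=> x _; exists 2 => _ [n _ <-]; exact: slope_le2.
  - by move=> x _; exists 0 => _ [n _ <-]; exact/ltW/slope_gt0.
  - by move=> n; exact: mslope.
(* Clamping gives [0 <= Z <= 2] at every point and does not change the limit where the slopes
   converge. *)
pose Z x := Num.max 0 (Num.min 2 (L x)).
have mZ : measurable_fun setT Z.
  by apply: measurable_maxr => //; exact: measurable_minr.
have fZ : {ae P, forall x, (fun n => slope (f n x)) @ \oo --> Z x}.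
  apply: filterS (slope_cvg fP) => x cx.
  suff -> : Z x = limn (fun n => slope (f n x)) by [].
  rewrite /Z /L cvg_limn_supE// max_r.
    by rewrite min_r// limr_le//; apply: nearW => n; exact: slope_le2.
  rewrite le_min ler0n/=; apply: limr_ge => //.
  by apply: nearW => n; exact/ltW/slope_gt0.
exists Z; split => //.
- move=> x; rewrite /Z le_max lexx/= ge_max ler0n/=.
  by rewrite ge_min lexx.
- exact: (slope_limit_gt0 Wcl NA fP mZ fZ).
- by move=> h C Wh; exact: (first_order fP mZ fZ Wh).
Qed.

End utility_minimization.

(** * Changes of measure *)

Section random_variable_classes.
Context d (T : measurableType d) (R : realType) (P : probability T R).
Local Notation L0 := {mfun_ P, T >-> R}.

Lemma L0_eqP (Y Z : L0) : Y = Z <-> Y = Z %[ae P].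
Proof.
split=> [->|YZ]; first exact: ae_eq_refl.
rewrite -[Y]reprK -[Z]reprK; apply/eqmodP/asboolP; exact: YZ.
Qed.

Lemma L0_class (f : T -> R) : measurable_fun setT f ->
  exists Y : L0, Y = f %[ae P].
Proof.
move=> mf; pose F : {mfun T >-> R} := mfun_Sub (mem_set mf).
exists (\pi_L0 F)%qT.
have : (repr (\pi_L0 F) = F %[mod L0])%qT by rewrite reprK.
by move=> /eqmodP/asboolP.
Qed.

Lemma L0_measurable (Y : L0) : measurable_fun setT Y.
Proof. exact: measurable_funPT. Qed.

End random_variable_classes.

(** * Probabilities given by a density *)

Section change_of_measure.
Context d (T : measurableType d) (R : realType).

Lemma ae_dominates (mu nu : {measure set T -> \bar R}) (A : set T) :
  nu `<< mu -> almost_everywhere mu A -> almost_everywhere nu A.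
Proof.
move=> /null_content_dominatesP numu [N [mN N0 AN]]; exists N; split => //.
exact: numu.
Qed.

Lemma ae_eq_integrable (mu : {measure set T -> \bar R}) (f g : T -> \bar R) :
  measurable_fun setT f -> ae_eq mu setT f g -> mu.-integrable setT g ->
  mu.-integrable setT f.
Proof.
move=> mf fg /integrableP[mg gy]; apply/integrableP; split => //.
rewrite (ae_eq_integral (fun x => `|g x|%E))//; try exact: measurableT_comp.
exact: ae_eq_abse.
Qed.

Context (P : probability T R) (D : T -> R).
Context (mD : measurable_fun setT D) (D_ge0 : forall x, 0 <= D x)
  (D1 : (\int[P]_x (D x)%:E = 1)%E).

Lemma probability_of_density : exists Q : probability T R,
  forall A, measurable A -> Q A = (\int[P]_(x in A) (D x)%:E)%E.
Proof.
pose nu A := (\int[P]_(x in A) (D x)%:E)%E.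
have mE A : measurable_fun A (fun x => (D x)%:E).
  by apply/measurable_EFinP; exact: measurable_funTS.
have D0 x : (0 <= (D x)%:E)%E by rewrite lee_fin.
have nu0 : nu set0 = 0%E by exact: integral_set0.
have nu_ge0 A : (0 <= nu A)%E by exact: integral_ge0.
have nu_sigma : semi_sigma_additive nu.
  move=> F mF tF mU; rewrite /nu ge0_integral_bigcup//.
  by apply: is_cvg_ereal_nneg_natsum_cond => n _ _; exact: integral_ge0.
pose nuM : {measure set T -> \bar R} :=
  HB.pack nu (isMeasure.Build d T R nu nu0 nu_ge0 nu_sigma).
pose Q : probability T R := HB.pack nu
  (isMeasure.Build d T R nu nu0 nu_ge0 nu_sigma)
  (Measure_isProbability.Build d T R nuM D1).
by exists Q.
Qed.

Context (Q : probability T R).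
Context (QE : forall A, measurable A -> Q A = (\int[P]_(x in A) (D x)%:E)%E).

Lemma density_dominates : Q `<< P.
Proof.
apply/null_content_dominatesP => A mA PA0; rewrite QE//.
apply: null_set_integral => //.
by apply: measurable_funTS; exact/measurable_EFinP.
Qed.

(** On a [Q]-null set the density vanishes [P]-almost everywhere, which positivity forbids unless
    the set is [P]-null. *)
Lemma density_equivalent : {ae P, forall x, 0 < D x} -> equivalent P Q.
Proof.
move=> Dgt0; split; first exact: density_dominates.
apply/null_content_dominatesP => A mA Q0.
have QA0 : (\int[P]_(x in A) (D x)%:E = 0)%E by rewrite -QE.
have : ae_eq P A (EFin \o D) (cst 0%E).
  apply/ae_eq_integral_abs => //.
    by apply: measurable_funTS; exact/measurable_EFinP.
  by under eq_integral do rewrite gee0_abs ?lee_fin//.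
move=> DA; apply/negligibleP => //.
suff : {ae P, forall x, ~ A x}.
  by move=> [N [mN N0 AN]]; exists N; split => // x Ax; apply: AN => /(_ Ax).
move: DA Dgt0; apply: filterS2 => x h Dx Ax.
by have /= [] := h Ax => D0; move: Dx; rewrite D0 ltxx.
Qed.

Lemma density_ae_eq : ae_eq P setT (Radon_Nikodym_SigmaFinite.f Q P) (EFin \o D).
Proof.
apply: integral_ae_eq => //.
- exact/Radon_Nikodym_SigmaFinite.f_integrable/density_dominates.
- exact/measurable_EFinP.
- move=> A _ mA; rewrite -QE// -Radon_Nikodym_SigmaFinite.f_integral//.
  exact: density_dominates.
Qed.

Lemma ge0_integral_density (f : T -> \bar R) A : measurable A ->
  measurable_fun A f -> (forall x, 0 <= f x)%E ->
  (\int[Q]_(x in A) f x = \int[P]_(x in A) (f x * (D x)%:E))%E.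
Proof.
move=> mA mf f0; have QP := density_dominates.
rewrite -(Radon_Nikodym_SigmaFinite.change_of_variables QP f0 mA mf).
have mRN : measurable_fun setT (Radon_Nikodym_SigmaFinite.f Q P).
  by have /integrableP[] := Radon_Nikodym_SigmaFinite.f_integrable QP.
apply: ae_eq_integral => //.
- by apply: emeasurable_funM => //; exact: measurable_funTS.
- apply: emeasurable_funM => //; apply: measurable_funTS.
  exact/measurable_EFinP.
- by apply: ae_eqe_mul2l; apply: ae_eq_subset density_ae_eq.
Qed.

Lemma integrable_density (h : T -> R) C : measurable_fun setT h ->
  (forall x, `|h x| * D x <= C) -> Q.-integrable setT (EFin \o h).
Proof.
move=> mh hC; apply/integrableP; split; first exact/measurable_EFinP.
rewrite (@ge0_integral_density (fun x => `|h x|%:E)%E) //; last first.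
  by apply/measurable_EFinP; exact: measurableT_comp.
under eq_integral do rewrite -EFinM.
apply: (integrable_lty measurableT (bounded_integrable P (C := C) _ _)).
  by apply: measurable_funM => //; exact: measurableT_comp.
by move=> x; rewrite ger0_norm// mulr_ge0.
Qed.

Lemma integral_density (h : T -> R) A : measurable A ->
  Q.-integrable setT (EFin \o h) ->
  (\int[Q]_(x in A) (h x)%:E = \int[P]_(x in A) (h x * D x)%:E)%E.
Proof.
move=> mA ih; have QP := density_dominates.
rewrite -(Radon_Nikodym_change_of_variables QP mA); last exact: integrableS ih.
have mh : measurable_fun setT h by have /integrableP[/measurable_EFinP] := ih.
apply: ae_eq_integral => //.
- apply: emeasurable_funM; apply: measurable_funTS; first exact/measurable_EFinP.
  exact/(measurable_int P)/Radon_Nikodym_integrable.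
- apply: measurable_funTS; apply/measurable_EFinP; exact: measurable_funM.
have h1 := ae_eq_Radon_Nikodym_SigmaFinite QP measurableT.
move: h1 density_ae_eq; apply: filterS2 => x /(_ I) h1 /(_ I) h2 _ /=.
by rewrite -h1 h2.
Qed.

Lemma density_bounded_pos C : (forall x, D x <= C) -> {ae P, forall x, 0 < D x} ->
  bounded_pos_density P Q.
Proof.
move=> DC Dgt0; have [Z ZD] := L0_class P mD.
have QP := density_dominates.
exists Z.
  split.
    apply/andP; split; first by apply/mem_set; exact: L0_measurable.
    apply/mem_set; rewrite /= /finite_norm unlock /Lnorm /= (@probability_setT _ _ _ P) lte01.
    apply: (@le_lt_trans _ _ C%:E); last exact: ltry.
    apply/ess_supP; apply: filterS ZD => x /(_ I) /= ->.
    by rewrite lee_fin ger0_norm.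
  have mZ : measurable [set x | 0 < Z x].
    rewrite -[X in measurable X]setTI.
    exact: (@measurable_fun_ltr _ _ R setT (cst 0) Z _ (L0_measurable Z)).
  rewrite -[X in P X]setCK probability_setC; last exact: measurableC.
  rewrite (_ : P _ = 0%E) ?sube0//; apply: measure_negligible.
    exact: measurableC.
  have : {ae P, forall x, 0 < Z x}.
    by move: ZD Dgt0; apply: filterS2 => x /(_ I) ->.
  by move=> [N [mN N0 ZN]]; exists N; split => // x Zx; apply: ZN.
have h1 := ae_eq_Radon_Nikodym_SigmaFinite QP measurableT.
move: h1 density_ae_eq ZD; apply: filterS3 => x /(_ I) h1 /(_ I) h2 /(_ I) h3 _ /=.
by rewrite -h1 h2 /= h3.
Qed.

End change_of_measure.

Section bounded_density.
Context d (T : measurableType d) (R : realType) (P Q : probability T R).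

(** The [Q]-mean of [|f|] is at most an essential bound of the density times its [P]-mean. *)
Lemma bounded_density_integrable (f : T -> R) : Q `<< P ->
  bounded_pos_density P Q -> P.-integrable setT (EFin \o f) ->
  Q.-integrable setT (EFin \o f).
Proof.
move=> QP [Z [ZL _] ZD] /integrableP[mf fy]; apply/integrableP; split => //.
have mZ := L0_measurable Z.
have [M ZM] : exists M : R, {ae P, forall x, `|Z x| <= M}.
  have /andP[_] := ZL; move=> /set_mem; rewrite /= /finite_norm unlock /Lnorm /=.
  rewrite (@probability_setT _ _ _ P) lte01 => /ess_supr_bounded.
  exact.
have mRN : measurable_fun setT (Radon_Nikodym_SigmaFinite.f Q P).
  by have /integrableP[] := Radon_Nikodym_SigmaFinite.f_integrable QP.
rewrite -(Radon_Nikodym_SigmaFinite.change_of_variables QP)//; last exact: measurableT_comp.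
have M0 : 0 <= Num.max 0 M by rewrite le_max lexx.
apply: (@le_lt_trans _ _ (\int[P]_x ((Num.max 0 M)%:E * `|(f x)%:E|))%E); last first.
  rewrite ge0_integralZl_EFin//; last exact: measurableT_comp.
  by rewrite lte_mul_pinfty// lee_fin.
apply: ae_ge0_le_integral => //.
- by move=> x _; rewrite mule_ge0// Radon_Nikodym_SigmaFinite.f_ge0.
- by apply: emeasurable_funM => //; exact: measurableT_comp.
- by move=> x _; rewrite mule_ge0.
- by apply: emeasurable_funM => //; exact: measurableT_comp.
have h1 := ae_eq_Radon_Nikodym_SigmaFinite QP measurableT.
move: h1 ZD ZM; apply: filterS3 => x /(_ I) -> /(_ I) /= <- ZM _.
rewrite muleC; apply: lee_wpmul2r => //; rewrite lee_fin.
by rewrite (le_trans (ler_norm _))// (le_trans ZM)// le_max lexx orbT.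
Qed.

End bounded_density.

(** * Integrals of gains *)

Section martingale_increments.
Import HBNNSimple.
Context d (T : measurableType d) (R : realType) (Q : probability T R).

(** Taking out what is known: the hypothesis passes from indicators to [G]-measurable simple
    functions, by dominated convergence to bounded nonnegative multipliers, and by a shift to all
    bounded ones. *)
Lemma integral_multiplier_eq0 (G : set (set T)) (h c : T -> R) (K : R) :
  G `<=` measurable -> sigma_algebra setT G -> Q.-integrable setT (EFin \o h) ->
  (forall A, G A -> (\int[Q]_(x in A) (h x)%:E = 0)%E) ->
  measurable_wrt G c -> (forall x, `|c x| <= K) ->
  (\int[Q]_x (c x * h x)%:E = 0)%E.
Proof.
move=> Gm sG ih h0 mc cK.
have GE A : G.-sigma.-measurable A -> G A.
  by rewrite /measurable /= sigma_algebra_id.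
have mh : measurable_fun setT h by have /integrableP[/measurable_EFinP] := ih.
have iM (c' : T -> R) K' : measurable_fun setT c' -> (forall x, `|c' x| <= K') ->
    Q.-integrable setT (EFin \o (fun x => c' x * h x)).
  move=> mc' c'K'; apply: (le_integrable measurableT _ _ (integrableZl measurableT K' ih)).
    by apply/measurable_EFinP; exact: measurable_funM.
  move=> x _; rewrite [leRHS](_ : _ = `|(K' * h x)%:E|%E)// lee_fin !normrM.
  apply: ler_wpM2r => //; exact: le_trans (c'K' x) (ler_norm _).
have indic0 A : G A -> (\int[Q]_x (\1_A x * h x)%:E = 0)%E.
  move=> GA; rewrite -(h0 A GA) [RHS]integral_mkcond; apply: eq_integral => x _.
  by rewrite patchE indicE; case: ifPn => _; rewrite ?mul1r ?mul0r.
have nng (c' : T -> R) K' : measurable_wrt G c' -> (forall x, 0 <= c' x <= K') ->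
    (\int[Q]_x (c' x * h x)%:E = 0)%E.
  move=> mc' c'K'.
  have mc'E : measurable_fun [set: g_sigma_algebraType G]
      (EFin \o c' : g_sigma_algebraType G -> \bar R).
    exact/measurable_EFinP.
  pose s := nnsfun_approx measurableT mc'E.
  have c'0 x : setT x -> (0 <= (EFin \o c') x)%E.
    by move=> _; rewrite lee_fin; have /andP[] := c'K' x.
  have s_cvg x : (fun n => s n x) @ \oo --> c' x.
    have := @cvg_approx _ (g_sigma_algebraType G) R setT (EFin \o c') x c'0 I (ltry _).
    by rewrite /=; under eq_fun do rewrite -(nnsfun_approxE measurableT mc'E).
  have s_le n x : `|s n x| <= K'.
    rewrite ger0_norm; last by rewrite /s; exact: fun_ge0.
    have := @le_approx _ (g_sigma_algebraType G) R setT (EFin \o c') n x c'0 I.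
    rewrite -(nnsfun_approxE measurableT mc'E) lee_fin => /le_trans; apply.
    by have /andP[] := c'K' x.
  have s_m n : measurable_fun [set: T] (s n : T -> R).
    by apply: (measurable_wrt_measurable Gm); exact: measurable_funPT.
  have i1 n y : Q.-integrable setT (EFin \o (fun x => \1_(s n @^-1` [set y]) x * h x)).
    apply: (iM _ 1).
      apply: measurable_indic; apply: Gm; apply: GE.
      by rewrite -[X in measurable X]setTI; exact: (@measurable_funPT _ _ _ _ (s n)).
    by move=> x; rewrite indicE ger0_norm//; case: (_ \in _).
  have s0 n : (\int[Q]_x (s n x * h x)%:E = 0)%E.
    under eq_integral do rewrite (fimfunEord (s n)) mulr_suml -sumEFin.
    rewrite integral_sum//=; last first.
      move=> i; under eq_fun do rewrite -mulrA EFinM.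
      by apply: integrableZl => //; exact: i1.
    rewrite big1// => i _; under eq_integral do rewrite -mulrA EFinM.
    rewrite (integralZl measurableT (i1 n _))/= indic0 ?mule0//.
    apply: GE; rewrite -[X in measurable X]setTI.
    exact: (@measurable_funPT _ _ _ _ (s n)).
  have msh n : measurable_fun [set: T] (fun x : T => (s n x * h x)%:E).
    by apply/measurable_EFinP; apply: measurable_funM => //; exact: s_m.
  have mch : measurable_fun setT (fun x => (c' x * h x)%:E).
    apply/measurable_EFinP; apply: measurable_funM => //.
    exact: measurable_wrt_measurable mc'.
  have [|||_ _ cv] := dominated_convergence measurableT msh mch (mu := Q)
      (g := fun x => (K'%:E * `|(h x)%:E|)%E).
  - apply: aeW => x _; apply: cvg_EFin; first exact: nearW.
    by apply: cvgM => //; exact: cvg_cst.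
  - by apply: integrableZl => //; exact: integrable_abse.
  - by apply: aeW => x n _; rewrite -EFinM lee_fin normrM ler_wpM2r.
  apply/esym; apply: (@cvg_unique _ (@ereal_hausdorff R) _ _ _ _ _ cv).
  by rewrite (_ : [sequence _]_n = cst 0%E); [exact: cvg_cst|exact/funext].
(* Adding [K] makes the multiplier nonnegative; the extra term [K h] has integral zero because [G]
   contains the whole space. *)
have cK' x : 0 <= c x + K <= K + K.
  by have := cK x; rewrite ler_norml => /andP[? ?]; apply/andP; split; lra.
have mcK : measurable_wrt G (fun x => c x + K).
  by apply: (@measurable_funD _ (g_sigma_algebraType G)) => //; exact: measurable_cst.
have := nng (fun x => c x + K) _ mcK cK'.
under eq_integral do rewrite mulrDl.
have ich : Q.-integrable setT (EFin \o (fun x => c x * h x)).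
  by apply: iM cK; exact: measurable_wrt_measurable mc.
have iKh : Q.-integrable setT (EFin \o (fun x => K * h x)).
  by apply: (iM (cst K) `|K|) => // x.
rewrite (integralD_EFin measurableT ich iKh)/=.
rewrite (_ : (\int[Q]_x (K * h x)%:E)%E = 0%E) ?adde0//.
under eq_integral do rewrite EFinM.
rewrite (integralZl measurableT ih)/= (h0 setT) ?mule0//.
by have [G0 GC _] := sG; rewrite -(setD0 setT); exact: GC.
Qed.

Lemma cvg_integral_truncation (A : set T) (y c : T -> R) : measurable A ->
  measurable_fun setT c -> Q.-integrable A (EFin \o y) ->
  (fun n => \int[Q]_(x in A `&` [set x | (`|c x| <= n%:R)%R]) (y x)%:E)%E @ \oo -->
  (\int[Q]_(x in A) (y x)%:E)%E.
Proof.
move=> mA mc iy; have /integrableP[my _] := iy.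
pose B n := [set x | `|c x| <= n%:R].
have mB n : measurable (B n).
  rewrite -[X in measurable X]setTI.
  apply: (@measurable_fun_ler _ _ R setT (fun x => `|c x|) (cst n%:R)) => //.
  exact: measurableT_comp.
have myB n : measurable_fun A ((EFin \o y) \_ (B n)).
  by apply/measurable_restrict => //; apply: measurable_funS my.
have [|||_ _] := dominated_convergence mA myB my (mu := Q) (g := abse \o (EFin \o y)).
- apply: aeW => x _; apply: cvg_near_cst.
  exists (Num.truncn `|c x|).+1 => // n /= cn; rewrite patchE mem_set// /B /=.
  by rewrite ltW// (lt_le_trans (truncnS_gt _))// ler_nat.
- exact: integrable_abse.
- apply: aeW => x n _; rewrite patchE; case: ifPn => // _.
  by rewrite abse0 abse_ge0.
by under eq_fun do rewrite -integral_mkcondr.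
Qed.

Context (I : eqType) (G_ : I -> set (set T)) (h_ : I -> T -> R).

(** The last clause says that the conditional expectation of [h_ k] given [G_ k] vanishes. *)
Definition martingale_increment k := [/\ G_ k `<=` measurable,
  sigma_algebra setT (G_ k), Q.-integrable setT (EFin \o h_ k) &
  forall A, G_ k A -> (\int[Q]_(x in A) (h_ k x)%:E = 0)%E].

(* Truncating the multiplier of the first increment to [|c| <= n] makes its
   contribution integrable with integral [0], and [n] goes to infinity last. *)
Lemma gain_span_integral_le s : nested_algebras G_ s ->
  (forall k, k \in s -> martingale_increment k) ->
  forall A (u w y : T -> R), measurable A -> (forall k, k \in s -> G_ k A) ->
  Q.-integrable A (EFin \o u) -> Q.-integrable A (EFin \o y) ->
  gain_span G_ h_ s w -> (forall x, A x -> y x <= u x + w x) ->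
  (\int[Q]_(x in A) (y x)%:E <= \int[Q]_(x in A) (u x)%:E)%E.
Proof.
elim: s => [|k s IH] /=.
  move=> _ _ A u w y mA _ iu iy -> yu; apply: le_integral => // x.
  by rewrite inE => /yu; rewrite addr0.
move=> /andP[/allP ks ns] Ms A u w y mA GA iu iy [c mc [w' sw' ->]] yu.
have [Gm sG ih h0] := Ms k (mem_head _ _).
have GE B : (G_ k).-sigma.-measurable B -> G_ k B.
  by rewrite /measurable /= sigma_algebra_id.
have mcT : measurable_fun setT c := measurable_wrt_measurable Gm mc.
pose B n := [set x | `|c x| <= n%:R].
have GAB n : G_ k (A `&` B n).
  apply: GE; apply: measurableI; first by apply: sub_sigma_algebra; apply: GA; exact: mem_head.
  rewrite -[X in measurable X]setTI.
  apply: (@measurable_fun_ler _ (g_sigma_algebraType (G_ k)) R setT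
    (fun x => `|c x|) (cst n%:R)) => //.
  by apply: measurableT_comp => //; exact: mc.
have mAB n : measurable (A `&` B n) := Gm _ (GAB n).
have sAB n : A `&` B n `<=` A by exact: subIsetl.
have h_int n : (\int[Q]_(x in A `&` B n) (c x * h_ k x)%:E = 0)%E.
  rewrite -(@integral_multiplier_eq0 (G_ k) (h_ k) (\1_(A `&` B n) \* c) n%:R)//.
  - rewrite [LHS]integral_mkcond; apply: eq_integral => x _.
    by rewrite patchE /= indicE; case: ifPn => _; rewrite ?mul1r ?mul0r.
  - apply: measurable_wrtM => //; apply: measurable_wrt_indic.
    by apply: sub_sigma_algebra; exact: GAB.
  - move=> x /=; rewrite indicE; case: (boolP (x \in _)) => [|_].
      by rewrite inE mul1r => -[].
    by rewrite mul0r normr0.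
have ich n : Q.-integrable (A `&` B n) (EFin \o (fun x => c x * h_ k x)).
  have ih' : Q.-integrable (A `&` B n) (EFin \o h_ k) by exact: integrableS ih.
  apply: (le_integrable (mAB n) _ _ (integrableZl (mAB n) n%:R ih')).
    apply: measurable_funTS; apply/measurable_EFinP; apply: measurable_funM => //.
    by have /integrableP[/measurable_EFinP] := ih.
  move=> x [_ cx]; rewrite [leRHS](_ : _ = `|(n%:R * h_ k x)%:E|%E)// lee_fin !normrM.
  by apply: ler_wpM2r => //; rewrite [leRHS]ger0_norm.
have le_n n : (\int[Q]_(x in A `&` B n) (y x)%:E <=
               \int[Q]_(x in A `&` B n) (u x)%:E)%E.
  have iun : Q.-integrable (A `&` B n) (EFin \o u) by exact: integrableS iu.
  (* The truncated gain has integral zero, so it can be absorbed into the integrable function [u].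
     The induction hypothesis then treats the remaining gain [w'], for which no integrability is
     known, on an event that belongs to all later algebras. *)
  have -> : (\int[Q]_(x in A `&` B n) (u x)%:E =
      \int[Q]_(x in A `&` B n) (u x + c x * h_ k x)%:E)%E.
    by rewrite (integralD_EFin (mAB n) iun (ich n))/= h_int adde0.
  apply: (IH ns _ _ _ w') => //.
  - by move=> l ls; apply: Ms; rewrite in_cons ls orbT.
  - by move=> l /ks/asboolP; apply.
  - by apply: eq_integrable (integrableD (mAB n) iun (ich n)) => //.
  - exact: integrableS iy.
  - by move=> x [/yu]; rewrite /= addrA.
rewrite -(cvg_lim (@ereal_hausdorff R) (cvg_integral_truncation mA mcT iy)).
rewrite -(cvg_lim (@ereal_hausdorff R) (cvg_integral_truncation mA mcT iu)).
apply: lee_lim.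
- by apply: cvgP (cvg_integral_truncation mA mcT iy).
- by apply: cvgP (cvg_integral_truncation mA mcT iu).
- exact: nearW.
Qed.

End martingale_increments.

(** * The market *)

Section market.
Context d0 (Omega : measurableType d0) (R : realType) (P : probability Omega R).
Context (T n : nat) (F : nat -> set (set Omega)) (X : 'I_n -> nat -> Omega -> R).
Context (HF : filtration T F) (X_adapted : forall i, adapted T F (X i)).
Local Notation L0 := {mfun_ P, Omega >-> R}.

(** Sorted by time, so that the algebras [F t.-1] increase along the list; index [t] stands for the
    period from [t.-1] to [t]. *)
Definition trades : seq (nat * 'I_n) :=
  [seq (t, i) | t <- index_iota 1 T.+1, i <- index_enum 'I_n].

Definition trade_algebra (k : nat * 'I_n) := F k.1.-1.

Definition price_increment (k : nat * 'I_n) w := X k.2 k.1 w - X k.2 k.1.-1 w.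

Local Notation attainable := (gain_span trade_algebra price_increment trades).

Lemma mem_trades t i : ((t, i) \in trades) = (1 <= t <= T)%N.
Proof.
apply/allpairsP/idP => [[[t' i'] /= [+ _ [-> _]]]|tT].
  by rewrite mem_index_iota ltnS.
by exists (t, i); split => //=; rewrite ?mem_index_iota ?ltnS// mem_index_enum.
Qed.

Lemma uniq_trades : uniq trades.
Proof.
apply: allpairs_uniq; [exact: iota_uniq|exact: index_enum_uniq|].
by move=> [a b] [a' b'].
Qed.

Lemma attainableP y : attainable y <-> exists2 xi, strategy T F xi & y = gains T X xi.
Proof.
rewrite (gain_spanP _ _ _ uniq_trades); split=> [[c mc ->]|[xi mxi ->]].
  exists (fun i t => c (t, i)).
    by move=> i t tT; apply: (mc (t, i)); rewrite mem_trades.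
  by apply/funext => w; rewrite /gains /trades big_allpairs.
exists (fun k => xi k.2 k.1).
  by move=> [t i]; rewrite mem_trades => tT; exact: mxi.
by apply/funext => w; rewrite /gains /trades big_allpairs.
Qed.

Lemma pairwise_trades : pairwise (fun k l : nat * 'I_n => (k.1 <= l.1)%N) trades.
Proof.
rewrite /trades /index_iota subSS subn0.
(* Induction on the number of periods, for an arbitrary first date. *)
elim: T 1%N => [//|m IH] a /=; rewrite pairwise_cat IH andbT; apply/andP; split.
  apply/allrelP => _ _ /mapP[i _ ->] /allpairsP[[t j] /= [+ _ ->]] /=.
  by rewrite mem_iota => /andP[/ltnW].
rewrite pairwise_map.
by elim: (index_enum _) => //= i s ->; rewrite andbT; apply/allP => j _ /=.
Qed.

Lemma nested_trades : nested_algebras trade_algebra trades.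
Proof.
have [_ _ FS] := HF.
have sub : {in [pred k : nat * 'I_n | (1 <= k.1 <= T)%N] &,
    subrel (fun k l : nat * 'I_n => (k.1 <= l.1)%N)
    (fun k l => `[< trade_algebra k `<=` trade_algebra l >])}.
  move=> [s i] [t j]; rewrite !inE /= => /andP[s0 sT] /andP[t0 tT] st.
  have h : (s.-1 <= t.-1 <= T)%N.
    by rewrite -!subn1 leq_sub2r//= leq_subLR (leq_trans tT)// leq_addl.
  exact: (FS _ _ h).
apply: (sub_in_pairwise sub) pairwise_trades.
by apply/allP => -[t i]; rewrite mem_trades.
Qed.

Lemma trade_algebraP k : k \in trades ->
  [/\ trade_algebra k `<=` measurable, sigma_algebra setT (trade_algebra k),
      measurable_wrt (F k.1) (X k.2 k.1) & measurable_wrt (trade_algebra k) (X k.2 k.1.-1)].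
Proof.
have [sF Fm _] := HF; move: k => [t i]; rewrite mem_trades => /andP[_ tT].
have t1T := leq_trans (leq_pred t) tT.
by split; [exact: Fm|exact: sF|exact: X_adapted|exact: X_adapted].
Qed.

Lemma measurable_price i t : (t <= T)%N -> measurable_fun setT (X i t).
Proof.
have [_ Fm _] := HF; move=> tT; apply: (measurable_wrt_measurable (Fm t tT)).
exact: X_adapted.
Qed.

Lemma measurable_attainable y : attainable y -> measurable_fun setT y.
Proof.
move=> /(gain_spanP _ _ _ uniq_trades)[c mc ->].
(* Coefficients are known to be measurable only for indices in [trades]; elsewhere the summand is
   replaced by [0], so that every summand is measurable. *)
rewrite (_ : (fun x => _) = (fun x => \sum_(k <- trades)
    (if k \in trades then c k x * price_increment k x else 0))); last first.
  by apply/funext => x; apply: eq_big_seq => k ->.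
apply: measurable_sum => k; case: (boolP (k \in trades)) => // kt.
have [Gm _ _ _] := trade_algebraP kt.
apply: measurable_funM; first exact: measurable_wrt_measurable (mc k kt).
move: k kt {Gm} => [t i]; rewrite mem_trades => /andP[_ tT].
by apply: measurable_funB; apply: measurable_price => //=; exact: leq_trans (leq_pred t) tT.
Qed.

Lemma K0P (Y : L0) : K0 P T F X Y <-> exists2 w, attainable w & Y = w %[ae P].
Proof.
split=> [[xi sxi Yxi]|[w /attainableP[xi sxi ->] Yw]]; last by exists xi.
by exists (gains T X xi) => //; apply/attainableP; exists xi.
Qed.

Lemma L0_zeroE : L0_zero P = cst 0 %[ae P].
Proof.
have : (repr (L0_zero P) = cst 0 %[mod L0])%qT by rewrite reprK.
by move=> /eqmodP/asboolP.
Qed.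

Lemma attainable0 : attainable (cst 0).
Proof.
by have [] := @module_over_gain_span _ _ R _ trade_algebra price_increment set0
  trades (fun _ _ => @sub0set _ _).
Qed.

Lemma NA_no_arbitrage : NA P T F X -> no_arbitrage P attainable.
Proof.
move=> NAX w Ww w0; have [Y Yw] := L0_class P (measurable_attainable Ww).
have Y0 : L0_zero P = Y.
  apply/esym; suff : (K0 P T F X `&` L0_ge0 P) Y by rewrite NAX.
  split; first by apply/K0P; exists w.
  by move: Yw w0; apply: filterS2 => x /(_ I) ->.
by move: Yw L0_zeroE; rewrite Y0; apply: filterS2 => x /(_ I) <- /(_ I) ->.
Qed.

(** The truncation of [Y] to [[0, 1]] is bounded, hence integrable under every probability. If its
    [Q]-mean is not positive it vanishes [Q]-almost surely, hence [P]-almost surely, and so does the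
    nonnegative [Y]. *)
Lemma NA_criterion (Q : probability Omega R) : equivalent P Q ->
  (forall Y : L0, K0 P T F X Y -> L0_ge0 P Y ->
    (\int[Q]_x (Num.max 0 (Num.min (Y x) 1))%:E <= 0)%E) -> NA P T F X.
Proof.
move=> [_ PQ] H; apply/seteqP; split=> [Y [KY Y0]|_ ->]; last first.
  split; first by apply/K0P; exists (cst 0); [exact: attainable0|exact: L0_zeroE].
  by apply: filterS L0_zeroE => x /(_ I) ->.
have mV : measurable_fun setT (fun x => Num.max 0 (Num.min (Y x) 1)).
  apply: measurable_maxr => //; apply: measurable_minr => //.
apply/L0_eqP.
have V0 : ae_eq Q setT (fun x => (Num.max 0 (Num.min (Y x) 1))%:E) (cst 0%E).
  apply/ae_eq_integral_abs => //; first exact/measurable_EFinP.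
  under eq_integral do rewrite gee0_abs ?lee_fin ?le_max ?lexx//.
  apply/eqP; rewrite eq_le H//=; apply: integral_ge0 => x _.
  by rewrite lee_fin le_max lexx.
have {}V0 := ae_dominates PQ V0.
move: V0 L0_zeroE Y0; apply: filterS3 => x /(_ I)[V0] /(_ I) zE Y0 _.
rewrite zE /=; move: V0; case: (leP (Y x) 1) => Y1.
  by rewrite max_r.
by rewrite max_r// => /eqP; rewrite oner_eq0.
Qed.

(** A nonnegative gain [Y] may fail to be integrable, but its truncation [V = Y - (Y - V)] is
    bounded and lies in the cone. *)
Lemma separating_NA (Q : probability Omega R) : equivalent P Q ->
  separating_measure Q (Ccone P T F X) -> NA P T F X.
Proof.
move=> PQ sep; apply: (NA_criterion PQ) => Y KY Y0.
have mV : measurable_fun setT (fun x => Num.max 0 (Num.min (Y x) 1)).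
  apply: measurable_maxr => //; apply: measurable_minr => //.
have mY := L0_measurable Y.
have [V VE] := L0_class P mV.
have [U UE] := L0_class P (measurable_funB mY mV).
have CV : Ccone P T F X V.
  split.
    exists Y => //; exists U.
      move: UE Y0; apply: filterS2 => x /(_ I) -> Y0 /=.
      by rewrite subr_ge0 ge_max Y0 ge_min lexx.
    by move: UE VE; apply: filterS2 => x /(_ I) /= -> /(_ I) ->  _; rewrite /= opprB addrC subrK.
  apply/Lfun1_integrable.
  have iV : P.-integrable setT (EFin \o (fun x => Num.max 0 (Num.min (Y x) 1))).
    apply: (@bounded_integrable _ _ _ _ _ 1) => // x.
    by rewrite ger0_norm ?le_max ?lexx// ge_max ler01 ge_min lexx orbT.
  apply: ae_eq_integrable iV; first exact/measurable_EFinP/L0_measurable.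
  by apply: filterS VE => x VE /VE /= ->.
have [_] := sep V CV; rewrite unlock.
rewrite (ae_eq_integral (fun x => (Num.max 0 (Num.min (Y x) 1))%:E))//.
- exact/measurable_EFinP/L0_measurable.
- exact/measurable_EFinP.
- by apply: (ae_dominates PQ.1); apply: filterS VE => x VE /VE /= ->.
Qed.

End market.

(** * No-arbitrage, martingale measures and separating measures *)

Section martingale_measures.
Context d0 (Omega : measurableType d0) (R : realType) (P : probability Omega R).
Context (T n : nat) (F : nat -> set (set Omega)) (X : 'I_n -> nat -> Omega -> R).
Context (HF : filtration T F) (X_adapted : forall i, adapted T F (X i)).
Local Notation L0 := {mfun_ P, Omega >-> R}.
Local Notation attainable :=
  (gain_span (trade_algebra F) (price_increment X) (trades T n)).

Lemma EMM_martingale_increment Q : EMM P T F X Q -> forall k, k \in trades T n ->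
  martingale_increment Q (trade_algebra F) (price_increment X) k.
Proof.
move=> [_ mart] k kt; have [Gm sG _ _] := trade_algebraP HF X_adapted kt.
move: k kt Gm sG => [t i]; rewrite mem_trades => /andP[t0 tT] Gm sG.
have [_ iX condX] := mart i.
have t1T := leq_trans (leq_pred t) tT.
have [iXt iXt1] := (iX t tT, iX _ t1T).
split => //; first by apply: eq_integrable (integrableB measurableT iXt iXt1).
move=> A GA; have mA := Gm _ GA.
have iA j : (j <= T)%N -> Q.-integrable A (EFin \o X i j).
  by move=> jT; apply: integrableS (iX j jT).
rewrite /price_increment (integralB_EFin mA (iA t tT) (iA _ t1T))/=.
have [_ _ /(_ A GA) ->] := condX t.-1 t ltac:(by rewrite leq_pred).
by rewrite subee// (integrable_fin_num mA (iA t tT)).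
Qed.

(** The gain [w] may fail to be integrable; only its integrable minorant is integrated. Passing to
    the minimum [y'] of [y] and [w] turns almost sure domination into domination at every point. *)
Lemma EMM_integral_le0 Q (y w : Omega -> R) : EMM P T F X Q -> attainable w ->
  Q.-integrable setT (EFin \o y) -> {ae Q, forall x, y x <= w x} ->
  (\int[Q]_x (y x)%:E <= 0)%E.
Proof.
move=> emm Ww iy yw; pose y' x := Num.min (y x) (w x).
have mw := measurable_attainable HF X_adapted Ww.
have my : measurable_fun setT y by have /integrableP[/measurable_EFinP] := iy.
have my' : measurable_fun setT y' by exact: measurable_minr.
have yE : ae_eq Q setT (EFin \o y') (EFin \o y).
  by apply: filterS yw => x yw _ /=; rewrite /y' min_l.
have iy' : Q.-integrable setT (EFin \o y').
  by apply: ae_eq_integrable iy => //; exact/measurable_EFinP.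
rewrite (ae_eq_integral (EFin \o y'))//; [|exact/measurable_EFinP..|exact: ae_eq_sym].
rewrite -[leRHS](integral0 Q setT).
apply: (@gain_span_integral_le _ _ _ Q _ (trade_algebra F) (price_increment X)
  (trades T n) _ _ setT (cst 0) w y') => //.
- exact: nested_trades.
- exact: EMM_martingale_increment.
- move=> k kt; have [_ [G0 GC _] _ _] := trade_algebraP HF X_adapted kt.
  by rewrite -(setD0 setT); exact: GC.
- exact: finite_measure_integrable_cst.
- by move=> x _; rewrite add0r /y' ge_min lexx orbT.
Qed.

Lemma EMM_NA Q : EMM P T F X Q -> NA P T F X.
Proof.
move=> emm; have [QP PQ] := emm.1.
apply: (NA_criterion emm.1) => Y /K0P[w Ww Yw] Y0.
apply: (EMM_integral_le0 emm Ww).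
  apply: (@bounded_integrable _ _ _ _ _ 1).
    apply: measurable_maxr => //; exact: measurable_minr.
  move=> x; rewrite ger0_norm ?le_max ?lexx// ge_max ler01 ge_min lexx orbT//.
have := ae_dominates QP Yw; have := ae_dominates QP Y0.
apply: filterS2 => x Yx0 /(_ I) <-.
by rewrite ge_max Yx0 ge_min lexx.
Qed.

(** The bounded density carries the [P]-integrability of elements of the cone over to [Q]. *)
Lemma EMM_separating Q : EMM P T F X Q -> bounded_pos_density P Q ->
  separating_measure Q (Ccone P T F X).
Proof.
move=> emm bd Y [[U /K0P[w Ww Uw] [V V0 YE]] Y1].
have QP := emm.1.1.
have iY : Q.-integrable setT (EFin \o Y).
  exact: bounded_density_integrable QP bd (iffLR (Lfun1_integrable _ _) Y1).
split.
  left; rewrite unlock.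
  exact: (integrable_lty measurableT (integrable_funrpos measurableT iY)).
rewrite unlock; apply: (EMM_integral_le0 emm Ww iY).
have : {ae P, forall x, Y x <= w x}.
  move: YE Uw V0; apply: filterS3 => x /(_ I) -> /(_ I) /= -> V0.
  by rewrite lerBlDr lerDl.
exact: ae_dominates.
Qed.

Let sumsq w := \sum_(i < n) \sum_(t < T.+1) X i t w ^+ 2.

(** Chosen so that prices and squared prices up to time [T], multiplied by [weight], are bounded by
    [1] under any law. *)
Let weight w := (1 + sumsq w) `^ (-1).

Let sumsq_ge0 w : 0 <= sumsq w.
Proof. by apply: sumr_ge0 => i _; apply: sumr_ge0 => t _; exact: sqr_ge0. Qed.

Let weightE w : weight w = (1 + sumsq w)^-1.
Proof. by rewrite /weight powR_inv1// addr_ge0. Qed.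

Let sumsq1_gt0 w : 0 < 1 + sumsq w.
Proof. by rewrite ltr_pwDl. Qed.

Let weight_gt0 w : 0 < weight w. Proof. by rewrite weightE invr_gt0. Qed.

Let measurable_weight : measurable_fun setT weight.
Proof.
apply: (@measurableT_comp _ _ _ _ _ _ (fun a : R => a `^ (-1))) => //=.
apply: measurable_funD => //; apply: measurable_sum => i.
apply: measurable_sum => t; apply: measurable_funX.
by apply: (measurable_price HF X_adapted); rewrite -ltnS.
Qed.

Let sqr_price_le i t w : (t <= T)%N -> X i t w ^+ 2 <= sumsq w.
Proof.
move=> tT; rewrite /sumsq (bigD1 i)//= (bigD1 (inord t))//= inordK ?ltnS//.
rewrite -addrA lerDl addr_ge0//; apply: sumr_ge0 => j _; first exact: sqr_ge0.
by apply: sumr_ge0 => u _; exact: sqr_ge0.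
Qed.

Let weight_le1 w : weight w <= 1.
Proof. by rewrite weightE invf_le1// lerDl. Qed.

Let weight_le w a C : a <= C * (1 + sumsq w) -> weight w * a <= C.
Proof. by move=> aC; rewrite weightE mulrC ler_pdivrMr. Qed.

Let norm_price_le i t w : (t <= T)%N -> `|X i t w| <= 1 + sumsq w.
Proof.
move=> tT; have := sqr_price_le i w tT.
have := sqr_ge0 (`|X i t w| - 1); rewrite -(real_normK (num_real (X i t w))).
have := sumsq_ge0 w; have := normr_ge0 (X i t w); set a := `|_|; nra.
Qed.

Lemma NA_EMM : NA P T F X -> exists2 Q, EMM P T F X Q & bounded_pos_density P Q.
Proof.
move=> NAX; have NAa := NA_no_arbitrage HF X_adapted NAX.
have nested := nested_trades n HF.
(* Over the algebra generated by [set0] the scalars are the constants: the attainable gains form a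
   vector space. *)
have [W0 WD WM] := @module_over_gain_span _ _ R _ (trade_algebra F)
  (price_increment X) set0 (trades T n) (fun _ _ => @sub0set _ _).
have WZ a w : attainable w -> attainable (fun x => a * w x).
  by move=> Ww; apply: (WM (cst a)) => //; exact: measurable_cst.
have [Z [mZ Z02 Zgt0 Zh]] := positive_annihilator measurable_weight weight_gt0
  weight_le1 (fun w => measurable_attainable HF X_adapted (y := w)) W0 WD WZ
  (dominated_closed_gain_span nested NAa) NAa.
pose D0 x := weight x * Z x.
have mD0 : measurable_fun setT D0 by exact: measurable_funM.
have Z0 x : 0 <= Z x by have /andP[] := Z02 x.
have D00 x : 0 <= D0 x by rewrite mulr_ge0// ltW.
have D02 x : D0 x <= 2.
  have /andP[_ Z2] := Z02 x; rewrite /D0 -[leRHS]mul1r.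
  by apply: ler_pM => //; exact: ltW.
have D0gt0 : {ae P, forall x, 0 < D0 x}.
  by apply: filterS Zgt0 => x Zx; rewrite mulr_gt0.
have iD0 : P.-integrable setT (EFin \o D0).
  by apply: (@bounded_integrable _ _ _ _ _ 2) => // x; rewrite ger0_norm.
pose c := fine (\int[P]_x (D0 x)%:E).
have cE : (\int[P]_x (D0 x)%:E = c%:E)%E.
  by rewrite fineK//; exact: (integrable_fin_num measurableT iD0).
have c0 : 0 < c.
  rewrite -lte_fin -cE lt_neqAle integral_ge0 ?andbT; last by move=> x _; rewrite lee_fin.
  apply/eqP => /esym I0.
  have : ae_eq P setT (EFin \o D0) (cst 0%E).
    apply/ae_eq_integral_abs => //; first exact/measurable_EFinP.
    by under eq_integral do rewrite gee0_abs ?lee_fin//.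
  move=> D0z; have : {ae P, forall x, False}.
    by move: D0z D0gt0; apply: filterS2 => x /(_ I)[->]; rewrite ltxx.
  move=> [N [mN N0 NT]].
  have := @probability_setT _ _ _ P; rewrite (_ : setT = N) ?N0.
    by move=> /eqP; rewrite eq_sym onee_eq0.
  by apply/seteqP; split => // x _; apply: NT => /=.
pose D x := c^-1 * D0 x.
have mD : measurable_fun setT D by exact: measurable_funM.
have Dge0 x : 0 <= D x by rewrite mulr_ge0// invr_ge0 ltW.
have D1 : (\int[P]_x (D x)%:E = 1)%E.
  under eq_integral do rewrite EFinM.
  by rewrite (integralZl measurableT iD0)/= cE -EFinM mulVf ?gt_eqF.
have Dgt0 : {ae P, forall x, 0 < D x}.
  by apply: filterS D0gt0 => x D0x; rewrite /D mulr_gt0 ?invr_gt0.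
have DC x : D x <= c^-1 * 2 by rewrite /D ler_wpM2l// invr_ge0 ltW.
have [Q QE] := probability_of_density mD Dge0 D1.
(* Since [D] is at most [2 / c] times [weight], a weighted bound on [h] suffices for
   [Q]-integrability. *)
have iQ (h : Omega -> R) C : measurable_fun setT h ->
    (forall x, weight x * `|h x| <= C) -> Q.-integrable setT (EFin \o h).
  move=> mh hC; apply: (integrable_density mD Dge0 QE (C := c^-1 * (2 * C)) mh) => x.
  rewrite /D mulrCA ler_wpM2l ?invr_ge0 ?(ltW c0)//.
  rewrite /D0 mulrA mulrC [`|h x| * _]mulrC.
  have /andP[Zx0 Zx2] := Z02 x.
  by apply: ler_pM => //; rewrite mulr_ge0// ltW.
have iX i t : (t <= T)%N -> Q.-integrable setT (EFin \o X i t).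
  move=> tT; apply: (iQ _ 1); first exact: measurable_price HF X_adapted _ _ tT.
  by move=> x; apply: weight_le; rewrite mul1r; exact: norm_price_le.
have incr0 i t A : (t.+1 <= T)%N -> F t A ->
    (\int[Q]_(x in A) (X i t.+1 x)%:E = \int[Q]_(x in A) (X i t x)%:E)%E.
  move=> tT FA; have [sF Fm FS] := HF; have tT' := ltnW tT.
  have mA : measurable A := Fm t tT' _ FA.
  have iA j : (j <= T)%N -> Q.-integrable A (EFin \o X i j).
    by move=> jT; apply: integrableS (iX i j jT).
  (* The gain from holding one unit of asset [i] from [t] to [t.+1] on the event [A]; the position
     carries the index [t.+1] and is [F t]-measurable. *)
  pose h x := \1_A x * (X i t.+1 x - X i t x).
  have Wh : attainable h.
    apply/attainableP; exists (fun j u => if (j == i) && (u == t.+1) then \1_A else cst 0).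
      move=> j u uT; case: ifPn => [/andP[_ /eqP ->]|_]; last exact: measurable_cst.
      by apply: measurable_wrt_indic; exact: sub_sigma_algebra.
    apply/funext => x; rewrite /gains (bigD1_seq t.+1)/= ?mem_index_iota ?iota_uniq//.
    rewrite (bigD1 i)//= !eqxx /= big1 ?addr0; last first.
      by move=> j /negbTE ->; rewrite mul0r.
    rewrite big1 ?addr0// => u /negbTE ut.
    by rewrite big1// => j _; rewrite ut andbF mul0r.
  have mh : measurable_fun setT h := measurable_attainable HF X_adapted Wh.
  have indic1 x : `|\1_A x| <= 1 :> R.
    by rewrite indicE ger0_norm//; case: (_ \in _).
  have hle x : `|h x| <= `|X i t.+1 x| + `|X i t x|.
    rewrite /h normrM -[leRHS]mul1r ler_pM// (le_trans (ler_normB _ _))//.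
  have h0 : (\int[P]_x (weight x * Z x * h x)%:E = 0)%E.
    (* The constant [4] serves both bounds: [|h| <= 2 (1 + sumsq)] and
       [h^2 <= 2 (p^2 + q^2) <= 4 sumsq]. *)
    apply: (Zh h 4 Wh) => x; apply: weight_le.
      apply: (le_trans (hle x)).
      have := norm_price_le i x tT; have := norm_price_le i x tT'.
      by have := sumsq_ge0 x; lra.
    rewrite -(real_normK (num_real (h x))).
    have := sqr_price_le i x tT; have := sqr_price_le i x tT'.
    rewrite -(real_normK (num_real (X i t x))) -(real_normK (num_real (X i t.+1 x))).
    have := hle x; have := normr_ge0 (h x); have := normr_ge0 (X i t x).
    have := normr_ge0 (X i t.+1 x); have := sumsq_ge0 x.
    set a := `|h x|; set p := `|X i t.+1 x|; set q := `|X i t x| => s0 p0 q0 a0 apq qs ps.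
    have : a ^+ 2 <= (p + q) ^+ 2 by rewrite ler_sqr ?nnegrE ?addr_ge0.
    by have := sqr_ge0 (p - q); lra.
  have ih : Q.-integrable setT (EFin \o (fun x => X i t.+1 x - X i t x)).
    by apply: eq_integrable (integrableB measurableT (iX i _ tT) (iX i _ tT')).
  have : (\int[Q]_(x in A) (X i t.+1 x - X i t x)%:E = 0)%E.
    rewrite (integral_density mD QE mA ih) integral_mkcond.
    transitivity (\int[P]_x (c^-1%:E * (weight x * Z x * h x)%:E))%E.
      apply: eq_integral => x _; rewrite patchE -EFinM /h indicE /D /D0.
      by case: ifPn => _; [rewrite mul1r; congr EFin; ring|rewrite mul0r !mulr0].
    rewrite integralZl ?h0 ?mule0//.
    (* Here [8 = 4 * 2], from [weight |h| <= 4] and [Z <= 2]. *)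
    apply: (@bounded_integrable _ _ _ _ _ 8).
      by apply: measurable_funM => //; exact: measurable_funM.
    move=> x; rewrite mulrAC normrM [leRHS](_ : _ = 4 * 2); last by ring.
    apply: ler_pM => //; last by rewrite ger0_norm//; have /andP[] := Z02 x.
    rewrite normrM gtr0_norm//; apply: weight_le; apply: (le_trans (hle x)).
    have := norm_price_le i x tT; have := norm_price_le i x tT'.
    by have := sumsq_ge0 x; lra.
  rewrite (integralB_EFin mA (iA _ tT) (iA _ tT'))/= => /eqP.
  rewrite sube_eq ?add0e; first by move/eqP.
    exact: (integrable_fin_num mA (iA _ tT)).
  exact: fin_num_adde_defl (integrable_fin_num mA (iA _ tT')).
have emm : EMM P T F X Q.
  split; first exact: (density_equivalent mD Dge0 QE Dgt0).
  move=> i; split => //; first by move=> t; exact: iX.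
  move=> s t /andP[st tT]; have sT := leq_trans st tT.
  split; [exact: X_adapted|exact: iX|].
  move=> A FA; have [_ _ FS] := HF.
  (* The one-period equalities are chained from [s] to [t]; each applies because [A] also belongs to
     the later algebras. *)
  elim: t st tT => [|t IH] st tT; first by move: st; rewrite leqn0 => /eqP ->.
  move: st; rewrite leq_eqVlt => /orP[/eqP <-//|]; rewrite ltnS => st.
  rewrite IH//; last exact: ltnW.
  rewrite incr0//; apply: (FS s t) => //; rewrite st; exact: ltnW.
exists Q => //.
exact: (density_bounded_pos mD Dge0 QE DC Dgt0).
Qed.

End martingale_measures.

Theorem theorem6p14 (R : realType) (disp : measure_display)
    (Omega : measurableType disp) (P : probability Omega R)
    (T d : nat) (F : nat -> set (set Omega))
    (X : 'I_d -> nat -> Omega -> R)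
    (HF : filtration T F)
    (X_adapted : forall i, adapted T F (X i))
    (X_ge0 : forall i t, (t <= T)%N -> \forall w \ae P, 0 <= X i t w) :
  [<-> NA P T F X;
       exists Q : probability Omega R, EMM P T F X Q;
       exists2 Q : probability Omega R, EMM P T F X Q & bounded_pos_density P Q;
       exists2 Q : probability Omega R, equivalent P Q &
         separating_measure Q (Ccone P T F X);
       exists Q : probability Omega R,
         [/\ equivalent P Q, separating_measure Q (Ccone P T F X) &
             bounded_pos_density P Q]].
Proof.
have NAQ := NA_EMM HF X_adapted.
(* The implications form a cycle. The steps from (ii) to (iii) and from (iv) to (v) return to
   no-arbitrage and construct a new measure, since the given one may have an unbounded density. *)
tfae.
- by move=> /NAQ[Q emm _]; exists Q.
- by move=> [Q /(EMM_NA HF X_adapted)/NAQ].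
- move=> [Q emm bd]; exists Q; first exact: emm.1.
  exact: (EMM_separating HF X_adapted).
- move=> [Q PQ /(separating_NA PQ)/NAQ[Q' emm bd]]; exists Q'; split => //.
    exact: emm.1.
  exact: (EMM_separating HF X_adapted).
- by move=> [Q [PQ sep _]]; exact: (separating_NA PQ sep).
Qed.
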